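(* Let $C$ be a nonempty closed convex subset of a real Hilbert space $H$. Let $S:C\to C$ be a nonexpansive mapping and let $T:C\to C$ be a demicontinuous mapping that is nearly nonexpansive with respect to a sequence $\{a_n\}_{n\ge 1}\subset[0,\infty)$ with $a_n\to 0$, such that $Fix(T)\neq\emptyset$. Let $V:C\to H$ be a $\gamma$-Lipschitzian mapping and let $F:C\to H$ be an $L$-Lipschitzian and $\eta$-strongly monotone operator, such that the coefficients satisfy $0<\mu<\frac{2\eta}{L^2}$ and $0\le\rho\gamma<\nu$, where $\nu=1-\sqrt{1-\mu(2\eta-\mu L^2)}$. For an arbitrary initial value $x_1\in C$, consider the sequence $\{x_n\}$ in $C$ generated by $$ \begin{cases} y_n=\beta_n Sx_n+(1-\beta_n)x_n,\\ x_{n+1}=P_C\left[\alpha_n\rho Vx_n+(I-\alpha_n\mu F)T^n y_n\right],\quad \forall n\ge 1, \end{cases} $$ where $\{\alpha_n\}$ and $\{\beta_n\}$ are sequences in $[0,1]$, with $\alpha_n\neq 0$ for all $n$, satisfying the conditions: (i) $\lim_{n\to\infty}\alpha_n=0$ and $\sum_{n=1}^\infty\alpha_n=\infty$; (ii) $\lim_{n\to\infty}\frac{a_n}{\alpha_n}=0$, $\lim_{n\to\infty}\frac{\beta_n}{\alpha_n}=0$, $\lim_{n\to\infty}\frac{|\alpha_n-\alpha_{n-1}|}{\alpha_n}=0$ and $\lim_{n\to\infty}\frac{|\beta_n-\beta_{n-1}|}{\alpha_n}=0$; (iii) $\lim_{n\to\infty}\|T^nx-T^{n-1}x\|=0$ and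 $\lim_{n\to\infty}\frac{\|T^nx-T^{n-1}x\|}{\alpha_n}=0$ for all $x\in C$. Then the sequence $\{x_n\}$ converges strongly to $x^*\in Fix(T)$, where $x^*$ is the unique solution of the variational inequality $$\langle(\rho V-\mu F)x^*,x-x^*\rangle\le 0,\quad\forall x\in Fix(T).$$
   Context: $H$ is a real Hilbert space with inner product $\langle\cdot,\cdot\rangle$ and norm $\|\cdot\|$; $P_C:H\to C$ is the metric (nearest-point) projection onto $C$; $I$ is the identity mapping; $T^n$ is the $n$-th iterate of $T$; $(I-\alpha_n\mu F)z=z-\alpha_n\mu Fz$ for $z\in C$; $Fix(T)=\{x\in C:Tx=x\}$. A mapping $S:C\to C$ is nonexpansive if $\|Sx-Sy\|\le\|x-y\|$ for all $x,y\in C$. A mapping $V:C\to H$ is $\gamma$-Lipschitzian, with $\gamma>0$, if $\|Vx-Vy\|\le\gamma\|x-y\|$ for all $x,y\in C$. A mapping $F:C\to H$ is $\eta$-strongly monotone, with $\eta>0$, if $\langle Fx-Fy,x-y\rangle\ge\eta\|x-y\|^2$ for all $x,y\in C$. Here $\mu,\rho$ are real numbers. Given $\{a_n\}\subset[0,\infty)$ with $a_n\to 0$, a mapping $T:C\to C$ is nearly nonexpansive with respect to $\{a_n\}$ if $\|T^nx-T^ny\|\le\|x-y\|+a_n$ for all $x,y\in C$ and all $n\ge 1$. $T$ is demicontinuous if whenever a sequence $\{z_n\}$ in $C$ converges strongly to $z$, the sequence $\{Tz_n\}$ converges weakly to $Tz$. The solution $x^*$ of the variational inequality is sought in $Fix(T)$.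 *)

(* Defs.v *)
(* MathComp-Analysis; the reals are an arbitrary [R : realType]. *)
From HB Require Import structures.
From mathcomp Require Export all_boot all_order all_algebra.
From mathcomp Require Export all_classical all_reals all_analysis.
From mathcomp Require Export sesquilinear.

Set Implicit Arguments.
Unset Strict Implicit.
Unset Printing Implicit Defensive.

Export Order.TTheory GRing.Theory Num.Theory.
Export numFieldNormedType.Exports.

Local Open Scope classical_set_scope.
Local Open Scope ring_scope.

(* A real Hilbert space is a complete normed module [H] together with an inner
   product [ip : {dot H for idfun}] (a symmetric positive definite bilinear
   form) satisfying [induces_norm ip].
   A mapping defined on [C] only is a total function on [H] about which nothing
   is assumed outside [C]. *)
Definition induces_norm (R : realType) (H : normedModType R)
    (ip : {dot H for idfun}) : Prop :=
  forall x : H, `|x| = Num.sqrt (ip x x).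

Definition weakly_cvg (R : realType) (H : normedModType R)
    (ip : {dot H for idfun}) (u : H^nat) (l : H) : Prop :=
  forall w : H, (fun n => ip (u n) w) @ \oo --> ip l w.

(* The nearest point of [C] to [z]. It exists and is unique when [C] is a
   nonempty closed convex subset of a Hilbert space; the default value 0 is only
   used when [z] has no nearest point in [C]. *)
Definition metric_proj (R : realType) (H : normedModType R)
    (C : set H) (z : H) : H :=
  xget 0 [set p | C p /\ forall q, C q -> `|z - p| <= `|z - q|].

Definition Fix (R : realType) (H : normedModType R)
    (C : set H) (T : H -> H) : set H :=
  [set x | C x /\ T x = x].

(* Nonexpansive and k-Lipschitzian mappings are the library's
   [1.-lipschitz_C S] and [k.-lipschitz_C V]. *)
Definition strongly_monotone (R : realType) (H : normedModType R)
    (ip : {dot H for idfun}) (C : set H) (eta : R) (F : H -> H) : Prop :=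
  forall x y, C x -> C y -> eta * `|x - y| ^+ 2 <= ip (F x - F y) (x - y).

Definition demicontinuous (R : realType) (H : normedModType R)
    (ip : {dot H for idfun}) (C : set H) (T : H -> H) : Prop :=
  forall (z_ : H^nat) (z : H), (forall n, C (z_ n)) -> C z ->
    z_ @ \oo --> z -> weakly_cvg ip (T \o z_) (T z).

(* Sequences are indexed from 1; their value at index 0 is irrelevant. *)
Definition nearly_nonexpansive (R : realType) (H : normedModType R)
    (C : set H) (a : R^nat) (T : H -> H) : Prop :=
  forall n : nat, (1 <= n)%N -> forall x y, C x -> C y ->
    `|iter n T x - iter n T y| <= `|x - y| + a n.

(* Main.v *)
Require Import Defs.
From HB Require Import structures.
From mathcomp Require Import all_boot all_order all_algebra.
From mathcomp Require Import all_classical all_reals all_analysis.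
From mathcomp Require Import sesquilinear.
From mathcomp Require Import ring lra zify.

Import Order.TTheory GRing.Theory Num.Theory.
Import numFieldNormedType.Exports.

Set Implicit Arguments.
Unset Strict Implicit.
Unset Printing Implicit Defensive.

Local Open Scope classical_set_scope.
Local Open Scope ring_scope.

(** Let [xs] be the solution of the variational inequality on [Fix C T]; it
    exists because [Fix C T] is closed and convex and [mu F - rho V] is strongly
    monotone and Lipschitzian ([vi_solution]). Put [v := rho V xs - mu F xs].
    The projection onto [C] and the contraction of [I - alpha n * mu F] turn one
    step of the scheme into
      [|x n.+1 - xs|^2 <= (1 - c alpha n) |x n - xs|^2
                          + 2 alpha n <v, x n.+1 - xs> + o(alpha n)]
    ([projected_step]). Since the [alpha n] are not summable, convergence
    follows once suitable averages of [<v, x n - xs>] are at most 0 in the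
    limit.

    The averages are not controlled through [x n.+1 - x n]: asymptotic
    regularity concerns the iterates of one point of [C] at a time, whereas
    comparing [x n.+1] with [x n] involves [T^n y - T^(n-1) y] at a point [y]
    that moves with [n].
    Instead, averages are taken through a generalized limit [L], linear,
    monotone and shift invariant like a Banach limit, built from the weights of
    the recurrence; invariance comes from the slow variation of [alpha], and [L]
    can be chosen so as to bound the limit superior of [|x n - xs|^2]
    ([relaxation_gen_lim]). If [q] is the mean of [x], defined by
    [L <x n, w> = <q, w>] for all [w], then [L <v, x n - xs> = <v, q - xs>], and
    this is at most 0 as soon as [q] is a fixed point of [T].

    To see that [q] is fixed, start from [x n.+1 - T^n (x n) --> 0]: locally [x]
    runs along a single orbit, with longer and longer strides.
    - Distances between points of such orbits do not increase in the limit when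
      both are moved along the orbit, while [L] does not see the shift of [n]
      ([orbit_transport]). Hence the points [T^(h n + o) (x n)], for [o] an
      integer, have stationary inner products under [L], and their distance to
      [x n] is monotone in [o] along steps of [h].
    - The mean ergodic theorem for this stationary family makes the averages
      over the lags before [o] and after [o] close, which forces the monotone
      quantity to be constant ([lag_corr_constant], [lag_dist_constant]).
    - By polarization, the increments [u n = T^m (x n) - x n] satisfy
      [L <u n, u (n + h)> <= O(a m)] when [h] divides [m]; if [m] is divisible
      by all small [h] the mean of [u] is therefore small ([increment_corr],
      [increment_mean_le]).
    - Comparing [L |T^m (x n) - T^m q|^2] with [L |x n - q|^2] then bounds
      [|T^m q - q|] ([mean_iter_le]), for arbitrarily large [m].
    Asymptotic regularity is finally applied at the single point [q]: together
    with demicontinuity it turns [T^m q --> q] along a subsequence into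
    [T q = q] ([gen_lim_mean_fixed]). *)

(** * Bounded sequences and generalized limits *)

Definition bounded_seq (R : realType) (V : normedModType R) (u : V^nat) :=
  exists M : R, forall n, `|u n| <= M.

Section BoundedSeq.
Context {R : realType}.

Lemma bounded_seq_near (V : normedModType R) (u : V^nat) (M : R) :
  (\forall n \near \oo, `|u n| <= M) -> bounded_seq u.
Proof.
case=> N _ uM; elim: N u uM => [|N IH] u uM.
  by exists M => n; exact: uM.
have [n Nn|K uK] := IH (fun n => u n.+1); first exact: uM.
exists (Num.max `|u 0%N| K) => -[|n]; first by rewrite le_max lexx.
by rewrite le_max uK orbT.
Qed.

Lemma bounded_seq_cst (V : normedModType R) (a : V) :
  bounded_seq (fun=> a : V).
Proof. by exists `|a|. Qed.

Lemma bounded_seqD (V : normedModType R) (u v : V^nat) :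
  bounded_seq u -> bounded_seq v -> bounded_seq (fun n => u n + v n).
Proof.
move=> [M uM] [K vK]; exists (M + K) => n.
by rewrite (le_trans (ler_normD _ _))// lerD.
Qed.

Lemma bounded_seqN (V : normedModType R) (u : V^nat) :
  bounded_seq u -> bounded_seq (fun n => - u n).
Proof. by move=> [M uM]; exists M => n; rewrite normrN. Qed.

Lemma bounded_seqB (V : normedModType R) (u v : V^nat) :
  bounded_seq u -> bounded_seq v -> bounded_seq (fun n => u n - v n).
Proof. by move=> bu bv; apply: bounded_seqD => //; exact: bounded_seqN. Qed.

Lemma bounded_seqM (u v : R^nat) :
  bounded_seq u -> bounded_seq v -> bounded_seq (fun n => u n * v n).
Proof.
move=> [M uM] [K vK]; exists (M * K) => n.
by rewrite normrM ler_pM.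
Qed.

Lemma bounded_seqX (u : R^nat) :
  bounded_seq u -> bounded_seq (fun n => u n ^+ 2).
Proof.
move=> bu; have [M uM] := bounded_seqM bu bu.
by exists M => n; rewrite expr2.
Qed.

Lemma bounded_seq_norm (V : normedModType R) (u : V^nat) :
  bounded_seq u -> bounded_seq (fun n => `|u n|).
Proof. by move=> [M uM]; exists M => n; rewrite normr_id. Qed.

Lemma bounded_seq_shift (V : normedModType R) (u : V^nat) (k : nat) :
  bounded_seq u -> bounded_seq (fun n => u (n + k)%N).
Proof. by move=> [M uM]; exists M. Qed.

Lemma bounded_seqS (V : normedModType R) (u : V^nat) :
  bounded_seq u -> bounded_seq (fun n => u n.+1).
Proof. by move=> [M uM]; exists M. Qed.

Lemma bounded_seq_cvg (u : R^nat) (l : R) :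
  u @ \oo --> l -> bounded_seq u.
Proof.
move=> /cvgrPdist_le /(_ 1 ltr01) ul.
apply: (@bounded_seq_near _ _ (`|l| + 1)).
apply: filterS ul => n ul.
have := ler_normB (l - u n) l.
rewrite [X in `|X|](_ : _ = - u n); last ring.
by rewrite normrN; lra.
Qed.

End BoundedSeq.

(** Banach limits. Only the values on bounded sequences are constrained. *)
Record gen_lim (R : realType) := GenLim {
  gen_lim_fun :> R^nat -> R ;
  gen_limD : forall u v : R^nat, bounded_seq u -> bounded_seq v ->
    gen_lim_fun (fun n => u n + v n) = gen_lim_fun u + gen_lim_fun v ;
  gen_limZ : forall (a : R) (u : R^nat), bounded_seq u ->
    gen_lim_fun (fun n => a * u n) = a * gen_lim_fun u ;
  gen_lim_cst : forall a, gen_lim_fun (fun=> a) = a ;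
  gen_limS : forall u : R^nat, bounded_seq u ->
    gen_lim_fun (fun n => u n.+1) = gen_lim_fun u ;
  gen_lim_le : forall u v : R^nat, bounded_seq u -> bounded_seq v ->
    (\forall n \near \oo, u n <= v n) -> gen_lim_fun u <= gen_lim_fun v }.

Section Averages.
Context {R : realType}.
Implicit Types (s b u v t : R^nat).

(** Once the excess of [s] over an upper bound [e] of [b] is below [e] it stays
    there, and as long as it is above [e] it decreases by at least [t n * e],
    which cannot go on since the series of the [t n] diverges. *)
Lemma le_relaxation t s b :
    (forall n, 0 <= t n <= 1) ->
    (fun N => \sum_(0 <= k < N) t k) @ \oo --> +oo ->
    (\forall n \near \oo, s n.+1 <= (1 - t n) * s n + t n * b n) ->
    (forall e, 0 < e -> \forall n \near \oo, b n <= e) ->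
  forall e, 0 < e -> \forall n \near \oo, s n <= e.
Proof.
move=> t01 tsum srec bsmall e e0.
have e20 : 0 < e / 2 by lra.
have [N _ HN] : \forall n \near \oo,
    s n.+1 <= (1 - t n) * s n + t n * b n /\ b n <= e / 2.
  by apply: filterI => //; exact: bsmall.
have step n : (N <= n)%N -> s n.+1 - e / 2 <= (1 - t n) * (s n - e / 2).
  by move=> /HN[sn bn]; have := t01 n; nra.
have stay n : (N <= n)%N -> s n <= e -> s n.+1 <= e.
  by move=> Nn sn; have := step n Nn; have := t01 n; nra.
have [[n [Nn sn]]|big] := pselect (exists n, (N <= n)%N /\ s n <= e).
  exists n => // m /= nm.
  rewrite -(subnK nm); elim: (m - n)%N => [|k IH]; first by rewrite add0n.
  by rewrite addSn; apply: stay => //; lia.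
have {}big n : (N <= n)%N -> e < s n.
  by move=> Nn; rewrite ltNge; apply/negP => sn; apply: big; exists n.
have drop k : s (N + k)%N - e / 2 <=
    s N - e / 2 - e / 2 * (\sum_(0 <= i < N + k) t i - \sum_(0 <= i < N) t i).
  elim: k => [|k IH]; first by rewrite addn0; lra.
  rewrite addnS big_nat_recr//=.
  have := @step (N + k)%N (leq_addr _ _); have := big (N + k)%N (leq_addr _ _).
  by have := t01 (N + k)%N; nra.
move/cvgryPge : tsum => /(_ (\sum_(0 <= i < N) t i + s N / (e / 2))) [M _ HM].
have := drop M; have := HM (N + M)%N (leq_addl _ _); have := big _ (leq_addr M N).
set S := \sum_(0 <= i < N + M) t i => sNM SM.
have : s N <= e / 2 * (S - \sum_(0 <= i < N) t i).
  rewrite mulrC -ler_pdivrMr//; lra.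
by lra.
Qed.

(** The mean of [u] for the weights [t k * \prod_(k < j < N) (1 - t j)], the
    remaining weight being put on [u 0]; the weights of this mean are those which
    the recurrence of [le_relaxation] puts on [b]. *)
Fixpoint relax t u (N : nat) : R :=
  if N is N'.+1 then (1 - t N') * relax t u N' + t N' * u N' else u 0%N.

Lemma relaxD t u v N :
  relax t (fun n => u n + v n) N = relax t u N + relax t v N.
Proof. by elim: N => //= N ->; ring. Qed.

Lemma relaxZ t a u N : relax t (fun n => a * u n) N = a * relax t u N.
Proof. by elim: N => //= N ->; ring. Qed.

Lemma relax_cst t a N : relax t (fun=> a) N = a.
Proof. by elim: N => //= N ->; ring. Qed.

Lemma relax_le t u v N : (forall n, 0 <= t n <= 1) -> (forall n, u n <= v n) ->
  relax t u N <= relax t v N.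
Proof.
move=> t01 uv; elim: N => //= N IH.
by have := t01 N; have := uv N; nra.
Qed.

Lemma relax_bounded t u M N : (forall n, 0 <= t n <= 1) ->
  (forall n, `|u n| <= M) -> `|relax t u N| <= M.
Proof.
move=> t01 uM; rewrite ler_norml; apply/andP; split.
  rewrite -[leLHS](relax_cst t _ N); apply: relax_le => // n.
  by have := uM n; rewrite ler_norml => /andP[].
rewrite -[leRHS](relax_cst t _ N); apply: relax_le => // n.
by have := uM n; rewrite ler_norml => /andP[].
Qed.

Lemma cvg0_le (u : R^nat) :
    (forall e, 0 < e -> \forall n \near \oo, `|u n| <= e) ->
  u @ \oo --> (0 : R).
Proof.
move=> H; apply/cvgrPdist_le => e e0; have := H e e0.
by apply: filterS => n; rewrite sub0r normrN.
Qed.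

Lemma cvg0_near (u : R^nat) : u @ \oo --> (0 : R) ->
  forall e, 0 < e -> \forall n \near \oo, `|u n| <= e.
Proof.
move=> /cvgrPdist_le H e e0; have := H e e0.
by apply: filterS => n; rewrite sub0r normrN.
Qed.

Lemma cvg0D (u v : R^nat) : u @ \oo --> (0 : R) -> v @ \oo --> (0 : R) ->
  (fun n => u n + v n) @ \oo --> (0 : R).
Proof. by move=> u0 v0; rewrite -[X in _ --> X](addr0 0); exact: cvgD. Qed.

Lemma cvg0Zl (k : R) (u : R^nat) : u @ \oo --> (0 : R) ->
  (fun n => k * u n) @ \oo --> (0 : R).
Proof.
move=> u0; rewrite -[X in _ --> X](mulr0 k).
by apply: cvgM => //; exact: cvg_cst.
Qed.

Lemma cvg0Zr (k : R) (u : R^nat) : u @ \oo --> (0 : R) ->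
  (fun n => u n * k) @ \oo --> (0 : R).
Proof. by move=> /(cvg0Zl k); under eq_fun do rewrite mulrC. Qed.

Lemma cvg0M (u v : R^nat) : u @ \oo --> (0 : R) -> v @ \oo --> (0 : R) ->
  (fun n => u n * v n) @ \oo --> (0 : R).
Proof.
by move=> u0 v0; rewrite -[X in _ --> X](mulr0 (0 : R)); exact: cvgM.
Qed.

Lemma relax_near0 t u :
    (forall n, 0 <= t n <= 1) ->
    (fun N => \sum_(0 <= k < N) t k) @ \oo --> +oo ->
    (forall e, 0 < e -> \forall n \near \oo, u n <= e) ->
  forall e, 0 < e -> \forall n \near \oo, relax t u n <= e.
Proof.
move=> t01 tsum usmall; apply: (@le_relaxation t _ u) => //.
by exists 0%N.
Qed.

(** Both sides obey the same relaxation up to the relative variation of the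
    weights, so that slowly varying weights make the average shift invariant
    in the limit. *)
Lemma relax_shift t u :
    (forall n, 0 <= t n <= 1) ->
    (fun N => \sum_(0 <= k < N) t k) @ \oo --> +oo ->
    t @ \oo --> (0 : R) ->
    (forall n, 0 < t n) ->
    (fun n => `|t n.+1 - t n| / t n) @ \oo --> (0 : R) ->
    bounded_seq u ->
  (fun N => relax t (fun n => u n.+1) N - relax t u N) @ \oo --> (0 : R).
Proof.
move=> t01 tsum t0 tpos tslow [M uM].
have M0 : 0 <= M := le_trans (normr_ge0 _) (uM 0%N).
pose d N := relax t (fun n => u n.+1) N - relax t u N.+1.
have dE N : d N.+1 =
    (1 - t N) * d N + (t N.+1 - t N) * (relax t u N.+1 - u N.+1).
  by rewrite /d /=; ring.
have wM N : `|relax t u N.+1 - u N.+1| <= M + M.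
  by rewrite (le_trans (ler_normB _ _))// lerD// relax_bounded.
have dsmall : d @ \oo --> (0 : R).
  apply: cvg0_le; apply: (@le_relaxation t _
      (fun n => (M + M) * (`|t n.+1 - t n| / t n))) => //.
  - exists 0%N => // N _ /=; rewrite dE (le_trans (ler_normD _ _))// lerD//.
      by rewrite normrM ger0_norm//; have := t01 N; lra.
    rewrite normrM [leRHS](_ : _ = `|t N.+1 - t N| * (M + M)) ?ler_wpM2l//.
    by field; rewrite gt_eqF.
  - move=> e e0; have : (fun n => (M + M) * (`|t n.+1 - t n| / t n))
        @ \oo --> (0 : R).
      exact: cvg0Zl.
    move=> /cvg0_near /(_ e e0); apply: filterS => n.
    exact/le_trans/ler_norm.
rewrite [X in X @ _](_ : _ =
    (fun N => d N + t N * (u N - relax t u N))); last first.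
  by apply/funext => N; rewrite /d /=; ring.
apply: cvg0D => //.
apply: cvg0_le => e e0.
have MM : 0 < M + M + 1 by lra.
have /(cvg0_near t0) : 0 < e / (M + M + 1) by rewrite divr_gt0.
apply: filterS => n tn; rewrite normrM.
have : `|u n - relax t u n| <= M + M.
  by rewrite (le_trans (ler_normB _ _))// lerD// relax_bounded.
move=> le2; rewrite (le_trans (ler_pM _ _ tn le2))//.
by rewrite -mulrA ler_piMr ?(ltW e0)// mulrC ler_pdivrMr//; lra.
Qed.

Lemma ultrafilter_image (T S : Type) (F : set_system T) (f : T -> S) :
  UltraFilter F -> UltraFilter (f @ F).
Proof.
move=> UF; split=> [|G GF FG]; first exact: fmap_proper_filter.
apply/seteqP; split => // A GA.
have [//|nFA] := in_ultra_setVsetC (f @^-1` A) UF.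
have /(filterI GA) : G (~` A) by exact: FG.
by rewrite setICr => /filter_not_empty.
Qed.

Lemma ultrafilter_cvg (F : set_system nat) (u : R^nat) :
  UltraFilter F -> bounded_seq u -> cvg (u @ F).
Proof.
move=> UF [M uM].
have := @segment_compact R (- M) M; rewrite compact_ultra.
move=> /(_ _ (ultrafilter_image u UF)) [|l [_ ul]].
  change (F (u @^-1` `[- M, M])); apply: filterE => n; rewrite /= in_itv /=.
  by have := uM n; rewrite ler_norml.
exact: (cvgP l).
Qed.

(** Solving the recurrence of [s] bounds it by the relaxed averages of [b];
    a limit of these averages along an ultrafilter that sees the indices where
    [s] is large is then a generalized limit of [b] that is at least [e]. *)
Lemma relaxation_gen_lim t s b (e : R) :
    (forall n, 0 <= t n <= 1) ->
    (fun N => \sum_(0 <= k < N) t k) @ \oo --> +oo ->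
    t @ \oo --> (0 : R) ->
    (forall n, 0 < t n) ->
    (fun n => `|t n.+1 - t n| / t n) @ \oo --> (0 : R) ->
    bounded_seq b ->
    (\forall n \near \oo, s n.+1 <= (1 - t n) * s n + t n * b n) ->
    ~ (\forall n \near \oo, s n <= e) ->
  exists L : gen_lim R, e <= L b.
Proof.
move=> t01 tsum t0 tpos tslow bb srec sbig.
(* The filter generated by the tails of [nat] and [[set n | e < s n]]. *)
pose G := [set A | exists2 B, (\oo : set_system nat) B &
                     B `&` [set n | e < s n] `<=` A].
have GP : ProperFilter G.
  split.
    move=> [B [N _ NB]] BA; apply: sbig; exists N => // n Nn.
    rewrite leNgt; apply/negP => esn; apply: (BA n); split => //.
    exact: NB.
  split.
  - by exists setT; [exact: filterT|].
  - move=> A A' [B FB BA] [B' FB' BA']; exists (B `&` B').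
      exact: filterI.
    by move=> n [[Bn B'n] sn]; split; [apply: BA|apply: BA'].
  - by move=> A A' AA' [B FB BA]; exists B => // n /BA /AA'.
have [F [UF GF]] := ultraFilterLemma GP.
have FF := @ultra_proper _ _ UF.
have ooF : (\oo : set_system nat) `<=` F.
  by move=> A ooA; apply: GF; exists A => // n [].
have cv u : bounded_seq u -> cvg (relax t u @ F).
  move=> [M uM]; apply: ultrafilter_cvg; exists M => n.
  exact: relax_bounded.
have D u v : bounded_seq u -> bounded_seq v ->
    lim (relax t (fun n => u n + v n) @ F) =
    lim (relax t u @ F) + lim (relax t v @ F).
  move=> bu bv.
  rewrite (_ : relax t _ = relax t u + relax t v).
    exact: limD (cv _ bu) (cv _ bv).
  by apply/funext => N; rewrite relaxD.
have Z a u : bounded_seq u ->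
    lim (relax t (fun n => a * u n) @ F) = a * lim (relax t u @ F).
  move=> bu; apply: cvg_lim => //.
  rewrite (_ : relax t _ = (fun N => a * relax t u N)); last first.
    by apply/funext => N; rewrite relaxZ.
  exact: cvgM (cvg_cst a) (cv u bu).
have cst a : lim (relax t (fun=> a) @ F) = a.
  apply: cvg_lim => //; rewrite (_ : relax t _ = (fun=> a)).
    exact: cvg_cst.
  by apply/funext => N; rewrite relax_cst.
have sh u : bounded_seq u ->
    lim (relax t (fun n => u n.+1) @ F) = lim (relax t u @ F).
  move=> bu; apply/eqP; rewrite -subr_eq0; apply/eqP.
  rewrite -limB; [|by apply: cv; exact: bounded_seqS|exact: cv].
  apply: cvg_lim => //.
  apply: (cvg_trans _ (relax_shift t01 tsum t0 tpos tslow bu)).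
  by move=> A; exact: ooF.
have le u v : bounded_seq u -> bounded_seq v ->
    (\forall n \near \oo, u n <= v n) ->
    lim (relax t u @ F) <= lim (relax t v @ F).
  move=> bu bv uv; apply/ler_addgt0Pr => d d0.
  rewrite -[leRHS]addrC -lerBlDr -[X in _ - X]mul1r -mulNr -Z// -D//; last first.
    by apply: bounded_seqM => //; exact: bounded_seq_cst.
  rewrite -(cst d); apply: ler_lim; [|exact: cv (bounded_seq_cst _)|].
    apply: cv; apply: bounded_seqD => //.
    by apply: bounded_seqM => //; exact: bounded_seq_cst.
  have small e' : 0 < e' -> \forall n \near \oo, u n + -1 * v n <= e'.
    by move=> e'0; apply: filterS uv => n uv; lra.
  apply: ooF; apply: filterS (relax_near0 t01 tsum small d0) => n.
  by rewrite relax_cst.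
exists (GenLim D Z cst sh le); rewrite /=.
apply/ler_addgt0Pr => d d0.
have sb : \forall n \near \oo, s n - relax t b n <= d.
  apply: (@le_relaxation t _ (fun=> 0)) => //.
    by apply: filterS srec => n; rewrite /=; lra.
  by move=> e' e'0; apply: filterE => _; exact: ltW.
have bd := @bounded_seq_cst R R d.
rewrite -(cst d) -D// -(cst e).
apply: (ler_lim (cv _ (@bounded_seq_cst R R e)) (cv _ (bounded_seqD bb bd))).
have Fs : F [set n | e < s n].
  by apply: GF; exists setT => [|n []//]; exact: filterT.
apply: filterS (filterI Fs (ooF _ sb)) => n [/= sn sbn].
by rewrite relax_cst relaxD relax_cst; lra.
Qed.

End Averages.

(** * Geometry of a real Hilbert space *)

Section InnerProduct.
Context {R : realType} {H : normedModType R}.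
Variable ip : {dot H for idfun}.
Hypothesis ip_norm : induces_norm ip.
Implicit Types x y z : H.

Lemma ipC x y : ip x y = ip y x.
Proof. by rewrite (@hermC _ _ _ _ ip x y) expr0 mul1r. Qed.

Lemma ipDl x y z : ip (x + y) z = ip x z + ip y z.
Proof. exact: linearDl. Qed.

Lemma ipDr x y z : ip z (x + y) = ip z x + ip z y.
Proof. by rewrite ipC ipDl !(ipC z). Qed.

Lemma ipZl (k : R) x y : ip (k *: x) y = k * ip x y.
Proof. exact: linearZl_LR. Qed.

Lemma ipZr (k : R) x y : ip x (k *: y) = k * ip x y.
Proof. by rewrite ipC ipZl ipC. Qed.

Lemma ipNl x y : ip (- x) y = - ip x y.
Proof. by rewrite -scaleN1r ipZl mulN1r. Qed.

Lemma ipNr x y : ip x (- y) = - ip x y.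
Proof. by rewrite ipC ipNl ipC. Qed.

Lemma ip0l x : ip 0 x = 0.
Proof. by rewrite -(scale0r x) ipZl mul0r. Qed.

Lemma ip0r x : ip x 0 = 0.
Proof. by rewrite ipC ip0l. Qed.

Lemma ip_ge0 x : 0 <= ip x x.
Proof.
have [->|x0] := eqVneq x 0; first by rewrite ip0l.
exact/ltW/neq0_dnorm_gt0.
Qed.

Lemma norm_sqr x : `|x| ^+ 2 = ip x x.
Proof. by rewrite ip_norm sqr_sqrtr// ip_ge0. Qed.

Definition ip_lin := (ipDl, ipDr, ipNl, ipNr, ipZl, ipZr).

Lemma norm_sqrD x y : `|x + y| ^+ 2 = `|x| ^+ 2 + 2 * ip x y + `|y| ^+ 2.
Proof. by rewrite !norm_sqr !ip_lin (ipC y x); ring. Qed.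

Lemma norm_sqrB x y : `|x - y| ^+ 2 = `|x| ^+ 2 - 2 * ip x y + `|y| ^+ 2.
Proof. by rewrite !norm_sqr !ip_lin (ipC y x); ring. Qed.

Lemma ip_polar x x' y y' :
  2 * ip (x' - x) (y' - y) =
  `|x' - y| ^+ 2 + `|x - y'| ^+ 2 - `|x' - y'| ^+ 2 - `|x - y| ^+ 2.
Proof. by rewrite !norm_sqrB !ip_lin; ring. Qed.

Lemma norm_sqr_convex (l : R) x y :
  `|l *: x + (1 - l) *: y| ^+ 2 =
  l * `|x| ^+ 2 + (1 - l) * `|y| ^+ 2 - l * (1 - l) * `|x - y| ^+ 2.
Proof.
rewrite norm_sqrB norm_sqrD !normrZ !exprMn !real_normK ?num_real// !ip_lin.
by ring.
Qed.

Lemma ip_young (k : R) x y : 0 < k ->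
  2 * ip x y <= `|x| ^+ 2 / k + k * `|y| ^+ 2.
Proof.
move=> k0; have := sqr_ge0 `|x - k *: y|.
rewrite norm_sqrB normrZ exprMn real_normK ?num_real// ipZr => h.
rewrite -subr_ge0 [leRHS](_ : _ =
  (`|x| ^+ 2 - 2 * (k * ip x y) + k ^+ 2 * `|y| ^+ 2) / k).
  by rewrite divr_ge0// ltW.
by field; rewrite gt_eqF.
Qed.

Lemma ip_le x y : ip x y <= `|x| * `|y|.
Proof.
have [->|x0] := eqVneq x 0; first by rewrite ip0l normr0 mul0r.
have [->|y0] := eqVneq y 0; first by rewrite ip0r normr0 mulr0.
have X : 0 < `|x| by rewrite normr_gt0.
have Y : 0 < `|y| by rewrite normr_gt0.
have := ip_young x y (divr_gt0 X Y).
rewrite [leRHS](_ : _ = 2 * (`|x| * `|y|)); first by rewrite ler_pM2l.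
by field; rewrite !gt_eqF.
Qed.

Lemma ip_norm_le x y : `|ip x y| <= `|x| * `|y|.
Proof.
rewrite ler_norml ip_le andbT lerNl -ipNl.
by rewrite (le_trans (ip_le _ _))// normrN.
Qed.

Lemma bounded_seq_ip (u v : H^nat) :
  bounded_seq u -> bounded_seq v -> bounded_seq (fun n => ip (u n) (v n)).
Proof.
move=> [M uM] [K vK]; exists (M * K) => n.
by rewrite (le_trans (ip_norm_le _ _))// ler_pM.
Qed.

Lemma ip_ext x y : (forall w, ip x w = ip y w) -> x = y.
Proof.
move=> xy; apply/eqP; rewrite -subr_eq0 -normr_eq0 -sqrf_eq0 norm_sqr.
by rewrite ipDl ipNl xy subrr.
Qed.

Lemma cvg_weakly (u : H^nat) (l : H) : u @ \oo --> l -> weakly_cvg ip u l.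
Proof.
move=> /cvgrPdist_le ul w; apply/cvgrPdist_le => e e0.
have W : 0 < `|w| + 1 by rewrite ltr_wpDl.
apply: filterS (ul _ (divr_gt0 e0 W)) => n lu.
rewrite -ipNl -ipDl (le_trans (ip_norm_le _ _))//.
rewrite (le_trans (ler_wpM2r (normr_ge0 w) lu))//.
rewrite mulrAC ler_pdivrMr// ler_pM2l//; lra.
Qed.

End InnerProduct.

Lemma convex_setP (R : realType) (H : normedModType R) (C : set H) :
  convex_set (C : set (convex_lmodType H)) <->
  forall x y (l : R), 0 <= l <= 1 -> C x -> C y -> C (l *: x + (1 - l) *: y).
Proof.
split=> [cC x y l /andP[l0 l1] Cx Cy|cC x y l /set_mem Cx /set_mem Cy].
  pose l' := Itv01 l0 l1.
  have /set_mem := cC x y l' (mem_set Cx) (mem_set Cy).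
  by [].
apply/mem_set; have := cC x y l%:num _ Cx Cy; apply.
by rewrite ge0 le1.
Qed.

Lemma closed_seq_lim (T : topologicalType) (K : set T) (u : T^nat) (l : T) :
  closed K -> (forall n, K (u n)) -> u @ \oo --> l -> K l.
Proof. by move=> clK Ku ul; apply: closed_cvg ul => //; exact: nearW. Qed.

Section Minimization.
Context {R : realType} {H : completeNormedModType R}.
Variable ip : {dot H for idfun}.
Hypothesis ip_norm : induces_norm ip.

(** The excess over the infimum controls distances through uniform convexity,
    so that a minimizing sequence is Cauchy. *)
Lemma uniformly_convex_min (K : set H) (g : H -> R) :
    closed K -> K !=set0 ->
    (forall x y, K x -> K y -> K (2^-1 *: (x + y))) ->
    (forall x, K x -> 0 <= g x) ->
    (forall x y, K x -> K y ->
      g (2^-1 *: (x + y)) <= (g x + g y) / 2 - `|x - y| ^+ 2 / 4) ->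
    (forall x e, K x -> 0 < e ->
      exists2 d, 0 < d & forall y, K y -> `|x - y| <= d -> g x <= g y + e) ->
  exists2 p, K p & forall x, K x -> g p <= g x.
Proof.
move=> clK [k0 Kk0] midK g0 gmid glsc.
have infK : has_inf (g @` K).
  by split; [exists (g k0), k0|exists 0 => _ [x Kx <-]; exact: g0].
pose m := inf (g @` K).
have mle x : K x -> m <= g x by move=> Kx; apply: (ge_inf infK.2); exists x.
have ex n : exists x, K x /\ g x <= m + n.+1%:R^-1.
  have [_ [x Kx <-] gx] := @inf_adherent _ (g @` K) n.+1%:R^-1
    ltac:(by rewrite invr_gt0) infK.
  by exists x; split=> //; exact: ltW.
pose u n := xget k0 [set x | K x /\ g x <= m + n.+1%:R^-1].
have uP n : K (u n) /\ g (u n) <= m + n.+1%:R^-1.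
  exact: (xgetPex k0 (ex n)).
have dist n k : `|u n - u k| ^+ 2 <= 2 * (n.+1%:R^-1 + k.+1%:R^-1).
  have [Kn gn] := uP n; have [Kk gk] := uP k.
  have := gmid _ _ Kn Kk; have := mle _ (midK _ _ Kn Kk).
  move: gn gk; set a := n.+1%:R^-1; set b := k.+1%:R^-1; set D := `|_| ^+ 2.
  lra.
have hs : harmonic @ \oo --> (0 : R) := cvg_harmonic.
have uc : cvg (u @ \oo).
  apply/cauchy_cvgP/cauchy_exP => e e0.
  have /(cvg0_near hs)[N _ HN] : 0 < e ^+ 2 / 8 by rewrite divr_gt0// exprn_gt0.
  exists (u N); exists N => // n Nn; rewrite /= -ball_normE /=.
  have : `|u N - u n| ^+ 2 < e ^+ 2.
    have := HN n Nn; have := HN N (leqnn N); rewrite /harmonic /=.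
    rewrite !ger0_norm ?invr_ge0// => HNN HNn.
    have := dist N n; have : 0 < e ^+ 2 by rewrite exprn_gt0.
    move: HNN HNn; set a := N.+1%:R^-1; set b := n.+1%:R^-1; lra.
  by rewrite ltr_pXn2r// nnegrE// ltW.
have Kl : K (lim (u @ \oo)).
  by apply: (closed_seq_lim clK _ uc) => n; exact: (uP n).1.
exists (lim (u @ \oo)) => // x Kx.
apply/ler_addgt0Pr => e e0; have e20 : 0 < e / 2 by lra.
have [d d0 gd] := glsc _ _ Kl e20.
near \oo => n.
have un : `|lim (u @ \oo) - u n| <= d.
  by near: n; move/cvgrPdist_le : uc => /(_ _ d0).
have hn : harmonic n <= e / 2 :> R.
  near: n; move/cvg0_near : hs => /(_ _ e20).
  by apply: filterS => n; exact/le_trans/ler_norm.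
have := gd _ (uP n).1 un; have := (uP n).2; have := mle _ Kx; move: hn.
by rewrite /harmonic /=; set a := n.+1%:R^-1; lra.
Unshelve. all: by end_near. Qed.

(** Stampacchia's theorem for the inner product: minimize
    [`|y| ^+ 2 - 2 * f y]. The choice [f = ip z] gives the projection of [z] and
    the choice [K = setT] gives the Riesz representation of [f]. *)
Lemma stampacchia (K : set H) (f : H -> R) (B : R) :
    closed K -> K !=set0 -> convex_set (K : set (convex_lmodType H)) ->
    (forall x y, f (x + y) = f x + f y) ->
    (forall (k : R) x, f (k *: x) = k * f x) ->
    0 <= B -> (forall x, `|f x| <= B * `|x|) ->
  exists2 p, K p & forall x, K x -> f (x - p) <= ip p (x - p).
Proof.
move=> clK K0 /convex_setP convK fD fZ B0 fB.
have fN x : f (- x) = - f x by rewrite -scaleN1r fZ mulN1r.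
have fle x : f x <= B * `|x| := le_trans (ler_norm _) (fB x).
pose g y := `|y| ^+ 2 - 2 * f y + B ^+ 2.
have midE (x y : H) : 2^-1 *: (x + y) = 2^-1 *: x + (1 - 2^-1) *: y.
  by rewrite scalerDr; congr (_ + _ *: _); lra.
have [] := @uniformly_convex_min K g clK K0.
- by move=> x y Kx Ky; rewrite midE; apply: convK => //; apply/andP; split; lra.
- move=> x _; rewrite /g.
  have := fle x; have := sqr_ge0 (`|x| - B); rewrite sqrrB; lra.
- move=> x y Kx Ky; rewrite /g fZ fD midE (norm_sqr_convex ip_norm).
  set X := `|x| ^+ 2; set Y := `|y| ^+ 2; set D := `|x - y| ^+ 2; lra.
- move=> x e Kx e0; have C0 : 0 < 2 * (`|x| + B) + 1.
    by have := normr_ge0 x; lra.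
  exists (e / (2 * (`|x| + B) + 1)) => [|y Ky xyd]; first by rewrite divr_gt0.
  have -> : g y = g x - 2 * ip x (x - y) + `|x - y| ^+ 2 + 2 * f (x - y).
    rewrite -[y in g y](subKr x y); move: (x - y) => w.
    by rewrite /g (norm_sqrB ip_norm) fD fN; ring.
  have := sqr_ge0 `|x - y|; have := ip_le ip_norm x (x - y).
  have := fB (x - y); rewrite ler_norml => /andP[+ _].
  have := normr_ge0 (x - y); move: xyd; rewrite ler_pdivlMr//.
  set D := `|x - y|; set X := `|x|; set P := ip x _; set Q := f _; nra.
move=> p Kp pmin; exists p => // x Kx; rewrite -subr_le0.
set b := f (x - p) - _; pose W := `|x - p| ^+ 2.
have W0 : 0 <= W by exact: sqr_ge0.
have bW (k : R) : 0 < k <= 1 -> 2 * b <= k * W.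
  move=> /andP[k0 k1].
  have Kz : K (k *: x + (1 - k) *: p) by apply: convK => //; rewrite (ltW k0).
  have := pmin _ Kz.
  have -> : k *: x + (1 - k) *: p = p + k *: (x - p).
    by rewrite scalerBl scale1r scalerBr addrC -!addrA [- _ + _]addrC.
  rewrite /g fD fZ (norm_sqrD ip_norm) normrZ exprMn ipZr.
  rewrite (ger0_norm (ltW k0)) -/W /b.
  set X := `|p| ^+ 2; set P := ip p _; set F := f (x - p) => h.
  by rewrite -(ler_pM2l k0); nra.
rewrite leNgt; apply/negP => b0.
(* If [0 < b], then [k := b / (b + W)] is small enough to contradict [bW]. *)
have bW0 : 0 < b + W by rewrite ltr_wpDr.
have k01 : 0 < b / (b + W) <= 1.
  by rewrite divr_gt0// ler_pdivrMr// mul1r lerDl.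
have := bW _ k01; rewrite mulrAC ler_pdivlMr// => h.
have bb : 0 < b * b by rewrite mulr_gt0.
have : 0 <= b * W by rewrite mulr_ge0// ltW.
lra.
Qed.

(** A point [p] of [C] with [ip (z - p) (y - p) <= 0] for all [y] in [C] is
    strictly nearer to [z] than any other point of [C], so that it must be the
    point chosen by [metric_proj]; [stampacchia] provides it. *)
Lemma metric_projP (C : set H) (z : H) :
    closed C -> C !=set0 -> convex_set (C : set (convex_lmodType H)) ->
  C (metric_proj C z) /\
  forall y, C y -> ip (z - metric_proj C z) (y - metric_proj C z) <= 0.
Proof.
move=> clC C0 convC.
have [||||p Cp pP] := @stampacchia C (ip z) `|z| clC C0 convC.
- by move=> x y; exact: ipDr.
- by move=> k x; exact: ipZr.
- exact: normr_ge0.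
- by move=> x; exact: ip_norm_le.
have {}pP y : C y -> ip (z - p) (y - p) <= 0.
  by move=> Cy; rewrite ipDl ipNl subr_le0 pP.
have closer y : C y -> `|z - p| ^+ 2 + `|y - p| ^+ 2 <= `|z - y| ^+ 2.
  move=> Cy; have -> : z - y = (z - p) - (y - p) by rewrite opprB subrKA.
  by rewrite (norm_sqrB ip_norm (z - p)); have := pP y Cy; lra.
have [Cm mP] : [set p | C p /\ forall q, C q -> `|z - p| <= `|z - q|]
    (metric_proj C z).
  apply: xgetPex; exists p; split=> // y Cy.
  rewrite -(@ler_pXn2r _ 2)// ?nnegrE//.
  by have := closer y Cy; have := sqr_ge0 `|y - p|; lra.
suff -> : metric_proj C z = p by [].
apply/eqP; rewrite -subr_eq0 -normr_eq0 -sqrf_eq0.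
have := closer _ Cm; have := mP _ Cp; rewrite -(@ler_pXn2r _ 2)// ?nnegrE//.
move=> h1 h2; rewrite eq_le sqr_ge0 andbT; lra.
Qed.

End Minimization.

(** * Generalized limits of sequences of vectors *)

Section GenLimTheory.
Context {R : realType} (L : gen_lim R).
Implicit Types u v : R^nat.

Lemma gen_limN u : bounded_seq u -> L (fun n => - u n) = - L u.
Proof.
move=> bu; rewrite -[RHS]mulN1r -gen_limZ//.
by congr (L _); apply/funext => n; rewrite mulN1r.
Qed.

Lemma gen_limB u v : bounded_seq u -> bounded_seq v ->
  L (fun n => u n - v n) = L u - L v.
Proof.
by move=> bu bv; rewrite gen_limD ?gen_limN//; exact: bounded_seqN.
Qed.

Lemma gen_lim_shift u k : bounded_seq u -> L (fun n => u (n + k)%N) = L u.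
Proof.
move=> bu; elim: k => [|k IH].
  by congr (L _); apply/funext => n; rewrite addn0.
rewrite -IH -[RHS]gen_limS; last exact: bounded_seq_shift.
by congr (L _); apply/funext => n; rewrite addnS.
Qed.

Lemma gen_lim_le_all u v : bounded_seq u -> bounded_seq v ->
  (forall n, u n <= v n) -> L u <= L v.
Proof. by move=> bu bv uv; apply: gen_lim_le => //; exact: nearW. Qed.

Lemma gen_lim_ge0 u : bounded_seq u -> (forall n, 0 <= u n) -> 0 <= L u.
Proof.
move=> bu u0; rewrite -(gen_lim_cst L 0).
by apply: gen_lim_le_all => //; exact: bounded_seq_cst.
Qed.

Lemma gen_lim_le_cst u M : bounded_seq u -> (forall n, u n <= M) -> L u <= M.
Proof.
move=> bu uM; rewrite -(gen_lim_cst L M).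
by apply: gen_lim_le_all => //; exact: bounded_seq_cst.
Qed.

Lemma gen_lim_le_eps u v : bounded_seq u -> bounded_seq v ->
  (forall e, 0 < e -> \forall n \near \oo, u n <= v n + e) -> L u <= L v.
Proof.
move=> bu bv uv; apply/ler_addgt0Pr => e e0.
have be := @bounded_seq_cst R R e.
rewrite -[X in _ + X](gen_lim_cst L) -gen_limD//.
by apply: gen_lim_le; [|exact: bounded_seqD|exact: uv].
Qed.

Lemma gen_lim_cvg u l : u @ \oo --> l -> L u = l.
Proof.
move=> ul; have bu := bounded_seq_cvg ul.
have bl := @bounded_seq_cst R R l.
rewrite -[RHS](gen_lim_cst L); apply/eqP; rewrite eq_le.
by apply/andP; split; apply: gen_lim_le_eps => // e e0;
  move/cvgrPdist_le : ul => /(_ e e0); apply: filterS => n;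
  rewrite ler_norml => /andP[]; lra.
Qed.

(** The form in which almost nonexpansive estimates of distances are used: an
    error that tends to [d] costs [O(d)] after squaring and taking limits. *)
Lemma gen_lim_sqr_le u v (eps : R^nat) (d B : R) :
    bounded_seq u -> (forall n, 0 <= u n) -> (forall n, 0 <= v n <= B) ->
    eps @ \oo --> d -> (\forall n \near \oo, u n <= v n + eps n) ->
  L (fun n => u n ^+ 2) <= L (fun n => v n ^+ 2) + (2 * B + `|d|) * `|d|.
Proof.
move=> bu u0 v0B epsd uv.
have bv : bounded_seq v.
  by exists B => n; have /andP[v0 vB] := v0B n; rewrite ger0_norm.
have errd : (fun n => (2 * B + `|eps n|) * `|eps n|) @ \oo -->
    (2 * B + `|d|) * `|d|.
  by apply: cvgM; [apply: cvgD; [exact: cvg_cst|]|]; exact: cvg_norm.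
have berr := bounded_seq_cvg errd.
rewrite -(gen_lim_cvg errd) -gen_limD//; last exact: bounded_seqX.
apply: gen_lim_le.
- exact: bounded_seqX.
- by apply: bounded_seqD => //; exact: bounded_seqX.
apply: filterS uv => n uv; have := u0 n; have /andP[] := v0B n.
by have := ler_norm (eps n); have := normr_ge0 (eps n); nra.
Qed.

End GenLimTheory.

Section GenLimVector.
Context {R : realType} {H : completeNormedModType R}.
Variable ip : {dot H for idfun}.
Hypothesis ip_norm : induces_norm ip.
Variable L : gen_lim R.

(** The Riesz representation of [fun w => L (fun n => ip (z n) w)]. *)
Lemma gen_lim_mean (z : H^nat) : bounded_seq z ->
  exists q : H, forall w, L (fun n => ip (z n) w) = ip q w.
Proof.
move=> bz; have [M zM] := bz.
have M0 : 0 <= M := le_trans (normr_ge0 _) (zM 0%N).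
have bzw w : bounded_seq (fun n => ip (z n) w).
  by apply: bounded_seq_ip => //; exact: bounded_seq_cst.
have zw w n : `|ip (z n) w| <= M * `|w|.
  by rewrite (le_trans (ip_norm_le ip_norm _ _))// ler_wpM2r.
have fD x y : L (fun n => ip (z n) (x + y)) =
    L (fun n => ip (z n) x) + L (fun n => ip (z n) y).
  by rewrite -gen_limD//; congr (L _); apply/funext => n; rewrite ipDr.
have fZ (k : R) x : L (fun n => ip (z n) (k *: x)) = k * L (fun n => ip (z n) x).
  by rewrite -gen_limZ//; congr (L _); apply/funext => n; rewrite ipZr.
have T0 : [set: H] !=set0 by exists 0.
have convT : convex_set ([set: H] : set (convex_lmodType H)) by apply/convex_setP.
have [|q _ qP] := stampacchia ip_norm closedT T0 convT fD fZ M0.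
  move=> x; rewrite ler_norml; apply/andP; split.
    rewrite lerNl -mulN1r -fZ.
    apply: gen_lim_le_cst => // n; rewrite (le_trans (ler_norm _))//.
    by rewrite (le_trans (zw _ _))// scaleN1r normrN.
  by apply: gen_lim_le_cst => // n; rewrite (le_trans (ler_norm _)).
exists q => w; apply/eqP; rewrite eq_le.
have := qP (w + q) I; rewrite addrK => ->/=.
have := qP (q - w) I; rewrite addrAC subrr add0r -scaleN1r fZ ipZr.
by rewrite !mulN1r lerN2.
Qed.

End GenLimVector.

(** * Orbits of nearly nonexpansive maps *)

Lemma cvg_nat_infty (E : nat -> nat) (c : nat) :
  (\forall n \near \oo, (n <= E n + c)%N) -> E @ \oo --> \oo.
Proof.
move=> [N0 _ HE] A [N _ HA]; exists (maxn N0 (N + c)) => // n /= Nn.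
apply: HA => /=; have := HE n; rewrite /=; lia.
Qed.

Section Transport.
Context {R : realType} {H : completeNormedModType R}.
Variable ip : {dot H for idfun}.
Hypothesis ip_norm : induces_norm ip.
Variables (C : set H) (T : H -> H) (a : R^nat).
Hypothesis T_C : forall x, C x -> C (T x).
Hypothesis a_0 : a 0%N = 0.
Hypothesis a_cvg0 : a @ \oo --> (0 : R).
Hypothesis T_near : forall k x y, C x -> C y ->
  `|iter k T x - iter k T y| <= `|x - y| + a k.

Lemma iter_C k x : C x -> C (iter k T x).
Proof. by move=> Cx; elim: k => //= k; exact: T_C. Qed.

(** Such a sequence follows one orbit of [T] with strides of growing length. *)
Definition asymp_orbit (w : H^nat) :=
  [/\ forall n, C (w n), bounded_seq w &
      (fun n => `|w n.+1 - iter n.+1 T (w n)|) @ \oo --> (0 : R)].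

Variable p : H.
Hypothesis Cp : C p.
Hypothesis Tp : T p = p.

Lemma iter_fix k : iter k T p = p.
Proof. by elim: k => //= k ->. Qed.

Lemma asymp_orbit_fix : asymp_orbit (fun=> p).
Proof.
split=> //; first exact: bounded_seq_cst.
rewrite [X in X @ _](_ : _ = (fun=> 0)); first exact: cvg_cst.
by apply/funext => n; rewrite iter_fix subrr normr0.
Qed.

Lemma bounded_iter (w : H^nat) (E : nat -> nat) :
  (forall n, C (w n)) -> bounded_seq w ->
  bounded_seq (fun n => iter (E n) T (w n)).
Proof.
move=> Cw [M wM]; have [K aK] := bounded_seq_cvg a_cvg0.
exists (M + `|p| + K + `|p|) => n.
rewrite -[iter _ _ _](subrK p) (le_trans (ler_normD _ _))// lerD//.
have := T_near (E n) (Cw n) Cp; rewrite iter_fix => /le_trans; apply.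
rewrite lerD//; last by rewrite (le_trans (ler_norm _)).
by rewrite (le_trans (ler_normB _ _))// lerD.
Qed.

Lemma cvg_error (E : nat -> nat) : E @ \oo --> \oo ->
  (fun n => a (E n)) @ \oo --> (0 : R).
Proof. by move=> EE; exact: (cvg_comp _ _ EE a_cvg0). Qed.

Variable L : gen_lim R.

(** Passing from index [n] to [n.+1] applies [iter n.+1 T] to both orbits and
    therefore does not increase distances in the limit, while a generalized
    limit does not see the shift of the index. *)
Lemma orbit_transport (w w' : H^nat) (E1 E1' E2 E2' F : nat -> nat) :
    asymp_orbit w -> asymp_orbit w' ->
    (fun n => a (E1 n)) @ \oo --> (0 : R) ->
    (fun n => a (E1' n)) @ \oo --> (0 : R) ->
    F @ \oo --> \oo ->
    (\forall n \near \oo, (E1 n.+1 + n.+1 = F n + E2 n)%N /\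
                          (E1' n.+1 + n.+1 = F n + E2' n)%N) ->
  L (fun n => `|iter (E1 n) T (w n) - iter (E1' n) T (w' n)| ^+ 2) <=
  L (fun n => `|iter (E2 n) T (w n) - iter (E2' n) T (w' n)| ^+ 2).
Proof.
move=> [Cw bw ow] [Cw' bw' ow'] a1 a1' FF EE.
have b1 : bounded_seq (fun n => `|iter (E1 n) T (w n) - iter (E1' n) T (w' n)|).
  by apply/bounded_seq_norm/bounded_seqB; exact: bounded_iter.
have [B b2] :
    bounded_seq (fun n => `|iter (E2 n) T (w n) - iter (E2' n) T (w' n)|).
  by apply/bounded_seq_norm/bounded_seqB; exact: bounded_iter.
rewrite -gen_limS; last exact: bounded_seqX.
pose eps n := `|w n.+1 - iter n.+1 T (w n)| + a (E1 n.+1) +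
  (`|w' n.+1 - iter n.+1 T (w' n)| + a (E1' n.+1)) + a (F n).
have eps0 : eps @ \oo --> (0 : R).
  rewrite -[X in _ --> X](_ : 0 + 0 + (0 + 0) + 0 = 0); last by rewrite !addr0.
  apply: cvgD; last exact: cvg_error.
  apply: cvgD; apply: cvgD => //.
  - by rewrite (cvg_shiftS (fun n => a (E1 n))).
  - by rewrite (cvg_shiftS (fun n => a (E1' n))).
have v0B n : 0 <= `|iter (E2 n) T (w n) - iter (E2' n) T (w' n)| <= B.
  by rewrite normr_ge0/= (le_trans (ler_norm _) (b2 n)).
suff step : \forall n \near \oo,
    `|iter (E1 n.+1) T (w n.+1) - iter (E1' n.+1) T (w' n.+1)| <=
    `|iter (E2 n) T (w n) - iter (E2' n) T (w' n)| + eps n.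
  have := gen_lim_sqr_le L (bounded_seqS b1) (fun n => normr_ge0 _) v0B eps0 step.
  by rewrite normr0 mulr0 addr0.
have orb (v : H^nat) (E : nat -> nat) n : (forall n, C (v n)) ->
    `|iter (E n.+1) T (v n.+1) - iter (E n.+1 + n.+1) T (v n)| <=
    `|v n.+1 - iter n.+1 T (v n)| + a (E n.+1).
  by move=> Cv; rewrite iterD; apply: T_near => //; exact: iter_C.
apply: filterS EE => n [e e'].
rewrite -[X in `|X|](subrKA (iter (F n + E2 n) T (w n))).
rewrite (le_trans (ler_normD _ _))//.
rewrite -[X in _ + `|X|](subrKA (iter (F n + E2' n) T (w' n))).
have := orb w E1 n Cw; rewrite e => h1.
have := orb w' E1' n Cw'; rewrite e' distrC => h2.
have := ler_normD (iter (F n + E2 n) T (w n) - iter (F n + E2' n) T (w' n))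
  (iter (F n + E2' n) T (w' n) - iter (E1' n.+1) T (w' n.+1)).
have := T_near (F n) (iter_C (E2 n) (Cw n)) (iter_C (E2' n) (Cw' n)).
rewrite -!iterD /eps; lra.
Qed.

(** * Stationarity of the lagged points of an orbit *)

Section Lags.
Variable z : H^nat.
Hypothesis orbz : asymp_orbit z.
Variable h : nat.
Hypothesis h_gt0 : (0 < h)%N.

(** Passing from [n] to [n + h] amounts to about [h * n] iterations, so that [h]
    is the distance of indices and [o] an offset inside the orbit. Lags are only
    meant for large [n], where the integer below is nonnegative. *)
Definition lag (o : int) (n : nat) : nat := absz ((h * n)%:Z + o).

Lemma lag_infty o : lag o @ \oo --> \oo.
Proof.
apply: (@cvg_nat_infty _ `|o|%N); apply: nearW => n; rewrite /lag.
by have : (n <= h * n)%N; [exact: leq_pmull|lia].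
Qed.

Let v (o : int) (n : nat) : H := iter (lag o n) T (z n) - p.

Lemma bounded_lag o : bounded_seq (v o).
Proof.
have [Cz bz _] := orbz; apply: bounded_seqB (bounded_seq_cst _).
exact: bounded_iter.
Qed.

Let bz : bounded_seq (fun n => z n - p).
Proof. by have [_ bz _] := orbz; apply: bounded_seqB (bounded_seq_cst _). Qed.

(** The [n.+1 + h] iterations between the lagged points at [n] and those at
    [n.+1] outnumber any fixed [e], whatever its sign; transport therefore gives
    both inequalities. *)
Lemma lag_dist_stationary o o' e :
  L (fun n => `|v o n - v o' n| ^+ 2) =
  L (fun n => `|v (o + e) n - v (o' + e) n| ^+ 2).
Proof.
have vB i j n : v i n - v j n = iter (lag i n) T (z n) - iter (lag j n) T (z n).
  by rewrite /v opprB subrKA.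
suff le i j d : L (fun n => `|v i n - v j n| ^+ 2) <=
    L (fun n => `|v (i + d) n - v (j + d) n| ^+ 2).
  apply/eqP; rewrite eq_le le/=.
  by have := le (o + e) (o' + e) (- e); rewrite !addrK.
under eq_fun do rewrite vB.
under [in leRHS]eq_fun do rewrite vB.
apply: (@orbit_transport z z _ _ _ _ (fun n => absz ((n.+1 + h)%:Z - d))) => //.
- by apply: cvg_error; exact: lag_infty.
- by apply: cvg_error; exact: lag_infty.
- by apply: (@cvg_nat_infty _ `|d|%N); apply: nearW => n; lia.
- exists (`|i| + `|j| + `|d|)%N => // n /= nd.
  have hn : (n <= h * n)%N by exact: leq_pmull.
  by rewrite /lag mulnS; lia.
Qed.

Lemma lag_norm_stationary o e :
  L (fun n => `|v o n| ^+ 2) = L (fun n => `|v (o + e) n| ^+ 2).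
Proof.
have vE i n : v i n = iter (lag i n) T (z n) - iter (lag i n) T p.
  by rewrite iter_fix.
suff le i d : L (fun n => `|v i n| ^+ 2) <= L (fun n => `|v (i + d) n| ^+ 2).
  apply/eqP; rewrite eq_le le/=.
  by have := le (o + e) (- e); rewrite addrK.
under eq_fun do rewrite vE.
under [in leRHS]eq_fun do rewrite vE.
apply: (@orbit_transport z (fun=> p) _ _ _ _ (fun n => absz ((n.+1 + h)%:Z - d))).
- exact: orbz.
- exact: asymp_orbit_fix.
- by apply: cvg_error; exact: lag_infty.
- by apply: cvg_error; exact: lag_infty.
- by apply: (@cvg_nat_infty _ `|d|%N); apply: nearW => n; lia.
- exists (`|i| + `|d|)%N => // n /= nd.
  have hn : (n <= h * n)%N by exact: leq_pmull.
  by rewrite /lag mulnS; lia.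
Qed.

Lemma lag_ip_stationary o o' e :
  L (fun n => ip (v o n) (v o' n)) = L (fun n => ip (v (o + e) n) (v (o' + e) n)).
Proof.
have ipE i j : L (fun n => ip (v i n) (v j n)) = 2^-1 *
    (L (fun n => `|v i n| ^+ 2) + L (fun n => `|v j n| ^+ 2) -
     L (fun n => `|v i n - v j n| ^+ 2)).
  have bi k : bounded_seq (fun n => `|v k n| ^+ 2).
    by apply/bounded_seqX/bounded_seq_norm; exact: bounded_lag.
  have bij : bounded_seq (fun n => `|v i n - v j n| ^+ 2).
    by apply/bounded_seqX/bounded_seq_norm/bounded_seqB; exact: bounded_lag.
  rewrite -gen_limD// -gen_limB//; last exact: bounded_seqD.
  rewrite -gen_limZ; last by apply: bounded_seqB => //; exact: bounded_seqD.
  by congr (L _); apply/funext => n; rewrite (norm_sqrB ip_norm (v i n)); field.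
by rewrite !ipE -lag_dist_stationary -!lag_norm_stationary.
Qed.

(** Averages over [2 ^ k] lags are formed by repeated halving, so that the
    parallelogram law alone gives the mean ergodic theorem. *)
Fixpoint lag_avg (k : nat) (o : int) (n : nat) : H :=
  if k is k'.+1
  then 2^-1 *: (lag_avg k' o n + lag_avg k' (o + (h * 2 ^ k')%:Z) n)
  else v o n.

Lemma bounded_lag_avg k o : bounded_seq (lag_avg k o).
Proof.
elim: k o => [|k IH] o; first exact: bounded_lag.
have [M HM] := bounded_seqD (IH o) (IH (o + (h * 2 ^ k)%:Z)).
exists (2^-1 * M) => n; rewrite /= normrZ ger0_norm// ler_pM2l//.
Qed.

Lemma lag_avg_stationary k o o' e :
  L (fun n => ip (lag_avg k o n) (lag_avg k o' n)) =
  L (fun n => ip (lag_avg k (o + e) n) (lag_avg k (o' + e) n)).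
Proof.
elim: k o o' => [|k IH] o o'; first exact: lag_ip_stationary.
have expand i j : L (fun n => ip (lag_avg k.+1 i n) (lag_avg k.+1 j n)) = 4^-1 *
    (L (fun n => ip (lag_avg k i n) (lag_avg k j n)) +
     L (fun n => ip (lag_avg k i n) (lag_avg k (j + (h * 2 ^ k)%:Z) n)) +
     L (fun n => ip (lag_avg k (i + (h * 2 ^ k)%:Z) n) (lag_avg k j n)) +
     L (fun n => ip (lag_avg k (i + (h * 2 ^ k)%:Z) n)
                    (lag_avg k (j + (h * 2 ^ k)%:Z) n))).
  have b i' j' : bounded_seq (fun n => ip (lag_avg k i' n) (lag_avg k j' n)).
    by apply: bounded_seq_ip => //; exact: bounded_lag_avg.
  rewrite -!gen_limD; do ?by do ?apply: bounded_seqD.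
  rewrite -gen_limZ; do ?by do ?apply: bounded_seqD.
  by congr (L _); apply/funext => n /=; rewrite !ip_lin; field.
have ac i : i + e + (h * 2 ^ k)%:Z = i + (h * 2 ^ k)%:Z + e by exact: addrAC.
rewrite !expand !ac (IH o o') (IH o (o' + (h * 2 ^ k)%:Z)).
by rewrite (IH (o + (h * 2 ^ k)%:Z) o') (IH (o + _) (o' + (h * 2 ^ k)%:Z)).
Qed.

(** The parallelogram law expresses the distance of two neighbouring averages by
    the decrease of the norms [r k], which cannot stay above [e / 4]. *)
Lemma lag_avg_ergodic (e : R) : 0 < e -> exists k, forall o,
  L (fun n => `|lag_avg k o n - lag_avg k (o + (h * 2 ^ k)%:Z) n| ^+ 2) <= e.
Proof.
move=> e0; pose r k := L (fun n => `|lag_avg k 0 n| ^+ 2).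
have b k o : bounded_seq (fun n => `|lag_avg k o n| ^+ 2).
  by apply/bounded_seqX/bounded_seq_norm; exact: bounded_lag_avg.
have rE k o : L (fun n => `|lag_avg k o n| ^+ 2) = r k.
  rewrite /r; under eq_fun do rewrite (norm_sqr ip_norm).
  under [in RHS]eq_fun do rewrite (norm_sqr ip_norm).
  by rewrite (lag_avg_stationary k 0 0 o) add0r.
have distE k o :
    L (fun n => `|lag_avg k o n - lag_avg k (o + (h * 2 ^ k)%:Z) n| ^+ 2) =
    4 * (r k - r k.+1).
  rewrite [RHS](_ : _ = 2 * r k + 2 * r k - 4 * r k.+1); last ring.
  rewrite -{1}(rE k o) -(rE k (o + (h * 2 ^ k)%:Z)) -(rE k.+1 o).
  have bM (c : R) j i : bounded_seq (fun n => c * `|lag_avg j i n| ^+ 2).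
    by apply: bounded_seqM => //; exact: bounded_seq_cst.
  rewrite -!gen_limZ// -gen_limD// -gen_limB//; last exact: bounded_seqD.
  congr (L _); apply/funext => n /=.
  rewrite normrZ exprMn (norm_sqrB ip_norm (lag_avg k o n)).
  rewrite (norm_sqrD ip_norm (lag_avg k o n)) ger0_norm//.
  by field.
have r0 k : 0 <= r k by apply: gen_lim_ge0 => // n; exact: sqr_ge0.
have [[k rk]|big] := pselect (exists k, 4 * (r k - r k.+1) <= e).
  by exists k => o; rewrite distE.
have {}big k : e < 4 * (r k - r k.+1).
  by rewrite ltNge; apply/negP => rk; apply: big; exists k.
have rdec k : 4 * r k <= 4 * r 0%N - k%:R * e.
  elim: k => [|k IH]; first by rewrite mul0r subr0.
  by rewrite -natr1; have := big k; lra.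
have := archi_boundP (divr_ge0 (mulr_ge0 (ler0n R 4) (r0 0%N)) (ltW e0)).
set k := Num.bound _; rewrite ltr_pdivrMr// => hk.
by have := rdec k; have := r0 k; lra.
Qed.

Lemma lag_distE i :
  L (fun n => `|z n - iter (lag i n) T (z n)| ^+ 2) =
  L (fun n => `|z n - p| ^+ 2) + L (fun n => `|v 0 n| ^+ 2) -
  2 * L (fun n => ip (z n - p) (v i n)).
Proof.
have b1 : bounded_seq (fun n => `|z n - p| ^+ 2).
  exact/bounded_seqX/bounded_seq_norm.
have b2 : bounded_seq (fun n => `|v i n| ^+ 2).
  by apply/bounded_seqX/bounded_seq_norm; exact: bounded_lag.
have b3 : bounded_seq (fun n => ip (z n - p) (v i n)).
  by apply: bounded_seq_ip => //; exact: bounded_lag.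
rewrite (lag_norm_stationary 0 i) add0r -gen_limZ// -gen_limD//.
rewrite -gen_limB//; [|exact: bounded_seqD|]; last first.
  by apply: bounded_seqM => //; exact: bounded_seq_cst.
congr (L _); apply/funext => n.
rewrite (_ : z n - _ = (z n - p) - v i n); last by rewrite /v opprB subrKA.
by rewrite (norm_sqrB ip_norm (z n - p)); ring.
Qed.

(** From [n] to [n.+1] the lag [o] grows by [h], while transport cannot increase
    the distance of the lagged point to the base point [z n]. *)
Lemma lag_corr_le o :
  L (fun n => ip (z n - p) (v (o + h%:Z) n)) <= L (fun n => ip (z n - p) (v o n)).
Proof.
suff : L (fun n => `|z n - iter (lag o n) T (z n)| ^+ 2) <=
       L (fun n => `|z n - iter (lag (o + h%:Z) n) T (z n)| ^+ 2).
  by rewrite !lag_distE; lra.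
apply: (@orbit_transport z z (fun=> 0%N) _ (fun=> 0%N) _ S) => //.
- by rewrite a_0; exact: cvg_cst.
- by apply: cvg_error; exact: lag_infty.
- by apply: (@cvg_nat_infty _ 0%N); apply: nearW => n; lia.
- exists `|o|%N => // n /= no.
  have hn : (n <= h * n)%N by exact: leq_pmull.
  by rewrite /lag mulnS; lia.
Qed.

(** A drop of the monotone correlation between consecutive lags would show up
    between the averages over the lags before it and over those after it, but
    these averages get close to each other. *)
Lemma lag_corr_constant o :
  L (fun n => ip (z n - p) (v (o + h%:Z) n)) = L (fun n => ip (z n - p) (v o n)).
Proof.
pose psi i := L (fun n => ip (z n - p) (v i n)).
pose psik k i := L (fun n => ip (z n - p) (lag_avg k i n)).
have bk k i : bounded_seq (fun n => ip (z n - p) (lag_avg k i n)).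
  by apply: bounded_seq_ip => //; exact: bounded_lag_avg.
have psikS k i :
    psik k.+1 i = 2^-1 * (psik k i + psik k (i + (h * 2 ^ k)%:Z)).
  rewrite /psik -gen_limD// -gen_limZ; last exact: bounded_seqD.
  by congr (L _); apply/funext => n /=; rewrite ipZr ipDr.
have mono i k : psi (i + (h * k)%:Z) <= psi i.
  elim: k => [|k IH]; first by rewrite muln0 addr0.
  rewrite (le_trans _ IH)// mulnS addnC PoszD addrA.
  exact: lag_corr_le.
have psik_le k i : psik k i <= psi i.
  elim: k i => [|k IH] i; first exact: lexx.
  rewrite psikS.
  have := IH i; have := IH (i + (h * 2 ^ k)%:Z); have := mono i (2 ^ k)%N.
  lra.
have psik_ge k i : psi (i + (h * (2 ^ k - 1))%:Z) <= psik k i.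
  elim: k i => [|k IH] i; first by rewrite expn0 subnn muln0 addr0.
  rewrite psikS; have h1 := IH (i + (h * 2 ^ k)%:Z).
  have k0 : (0 < 2 ^ k)%N by rewrite expn_gt0.
  have e2 : (h * (2 ^ k.+1 - 1))%:Z =
      (h * 2 ^ k)%:Z + (h * (2 ^ k - 1))%:Z :> int.
    by rewrite -PoszD -mulnDr expnS; congr (Posz (_ * _)); lia.
  have h2 := mono (i + (h * (2 ^ k - 1))%:Z) (2 ^ k)%N.
  rewrite e2 addrA; have := IH i; rewrite addrAC in h2; lra.
have [B zB] := bz.
apply/eqP; rewrite eq_le lag_corr_le/= -subr_le0 -/(psi o) -/(psi (o + h%:Z)).
apply/ler_addgt0Pr => e e0; rewrite add0r.
have B1 : 0 < B ^+ 2 + 1 by rewrite ltr_wpDl// sqr_ge0.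
pose d := e / (B ^+ 2 + 1).
have d0 : 0 < d by rewrite divr_gt0.
have [k kP] := lag_avg_ergodic (mulr_gt0 d0 d0).
(* The first of the [2 ^ k] lags that end with [o]. *)
pose i := o - (h * (2 ^ k - 1))%:Z.
have k0 : (0 < 2 ^ k)%N by rewrite expn_gt0.
have := psik_ge k i; rewrite /i subrK => lo.
have := psik_le k (o + h%:Z).
have -> : o + h%:Z = i + (h * 2 ^ k)%:Z.
  rewrite /i -addrA; congr (_ + _).
  by rewrite mulnBr muln1 -[in RHS]subzn ?leq_pmulr//; lia.
have {kP} := kP i; rewrite -/i in lo *.
move=> hd hi.
suff : psik k i - psik k (i + (h * 2 ^ k)%:Z) <= e by lra.
pose D n := lag_avg k i n - lag_avg k (i + (h * 2 ^ k)%:Z) n.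
have bD : bounded_seq (fun n => `|D n| ^+ 2).
  by apply/bounded_seqX/bounded_seq_norm/bounded_seqB; exact: bounded_lag_avg.
have bDd : bounded_seq (fun n => (2 * d)^-1 * `|D n| ^+ 2).
  by apply: bounded_seqM => //; exact: bounded_seq_cst.
have bB := @bounded_seq_cst R R (d * B ^+ 2 / 2).
have : L (fun n => ip (z n - p) (D n)) <=
    L (fun n => d * B ^+ 2 / 2 + (2 * d)^-1 * `|D n| ^+ 2).
  apply: gen_lim_le_all; [|exact: bounded_seqD|].
    by apply: bounded_seq_ip => //; apply: bounded_seqB; exact: bounded_lag_avg.
  move=> n; have dV : 0 < d^-1 by rewrite invr_gt0.
  have := ip_young ip_norm (z n - p) (D n) dV; rewrite invrK => y.
  have zB2 : `|z n - p| ^+ 2 <= B ^+ 2.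
    by rewrite lerXn2r ?nnegrE// (le_trans _ (zB n)).
  have : `|z n - p| ^+ 2 * d <= B ^+ 2 * d by rewrite ler_pM2r.
  by rewrite invfM; lra.
rewrite (gen_limD L bB bDd) gen_lim_cst (gen_limZ L _ bD).
rewrite (_ : L (fun n => ip (z n - p) (D n)) =
  psik k i - psik k (i + (h * 2 ^ k)%:Z)); last first.
  rewrite /psik -gen_limB//; congr (L _); apply/funext => n.
  by rewrite /D ipDr ipNr.
move=> /le_trans; apply.
have : (2 * d)^-1 * L (fun n => `|D n| ^+ 2) <= (2 * d)^-1 * (d * d).
  by rewrite ler_pM2l// invr_gt0 mulr_gt0.
have -> : (2 * d)^-1 * (d * d) = d / 2 by field; rewrite gt_eqF.
have : d * (B ^+ 2 + 1) = e by rewrite /d divfK// gt_eqF.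
lra.
Qed.

Lemma lag_dist_constant o (k : nat) :
  L (fun n => `|z n - iter (lag (o + (h * k)%:Z) n) T (z n)| ^+ 2) =
  L (fun n => `|z n - iter (lag o n) T (z n)| ^+ 2).
Proof.
elim: k => [|k IH]; first by rewrite muln0 addr0.
by rewrite -IH !lag_distE mulnS addnC PoszD addrA lag_corr_constant.
Qed.

End Lags.

(** * The mean of an asymptotic orbit *)

Section Mean.
Variables (z : H^nat) (q : H).
Hypothesis orbz : asymp_orbit z.
Hypothesis Cq : C q.
Hypothesis qP : forall w, L (fun n => ip (z n) w) = ip q w.

(** The exponent is the sum of [n.+1], ..., [n + h]. *)
Lemma orbit_shift h :
  (fun n => `|z (n + h)%N - iter (h * n + 'C(h.+1, 2)) T (z n)|) @ \oo -->
    (0 : R).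
Proof.
have [Cz _ oz] := orbz.
elim: h => [|h IH].
  rewrite [X in X @ _](_ : _ = (fun=> 0)); first exact: cvg_cst.
  by apply/funext => n; rewrite addn0 mul0n bin_small// subrr normr0.
pose eps n := `|z (n + h).+1 - iter (n + h).+1 T (z (n + h)%N)| +
  (`|z (n + h)%N - iter (h * n + 'C(h.+1, 2)) T (z n)| + a (n + h).+1).
have eps0 : eps @ \oo --> (0 : R).
  rewrite -[X in _ --> X](_ : 0 + (0 + 0) = 0); last by rewrite !addr0.
  apply: cvgD; first by have := oz; rewrite -(cvg_shiftn h).
  apply: cvgD => //; apply: (@cvg_error (fun n => (n + h).+1)).
  by apply: (@cvg_nat_infty _ 0%N); apply: nearW => n; lia.
apply: cvg0_le => e e0; apply: filterS (cvg0_near eps0 e0) => n.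
rewrite normr_id => /(le_trans (ler_norm _)); apply: le_trans.
have -> : (h.+1 * n + 'C(h.+2, 2) = (n + h).+1 + (h * n + 'C(h.+1, 2)))%N.
  by rewrite binS bin1 mulSn; lia.
rewrite addnS iterD -[X in `|X|](subrKA (iter (n + h).+1 T (z (n + h)%N))).
rewrite (le_trans (ler_normD _ _))// lerD//.
by apply: T_near => //; exact: iter_C.
Qed.

Variable B : R.
Hypothesis orbB : forall k n, `|iter k T (z n) - p| <= B.
Hypothesis qB : forall k, `|iter k T q - p| <= B.

Let orb_dist k n k' n' : `|iter k T (z n) - iter k' T (z n')| <= 2 * B.
Proof.
rewrite -[X in `|X|](subrKA p) (le_trans (ler_normD _ _))//.
by have := orbB k n; have := orbB k' n'; rewrite (distrC p); lra.
Qed.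

Let B_ge0 : 0 <= B := le_trans (normr_ge0 _) (orbB 0 0).

Let bdist k n k' n' : bounded_seq
  (fun i => `|iter (k i) T (z (n i)) - iter (k' i) T (z (n' i))|).
Proof. by exists (2 * B) => i; rewrite normr_id. Qed.

Let err m := (2 * (2 * B) + `|a m|) * `|a m|.

Let dist_le k n k' n' l i l' i' (eps : R^nat) (d : R) :
    eps @ \oo --> d ->
    (\forall j \near \oo,
      `|iter (k j) T (z (n j)) - iter (k' j) T (z (n' j))| <=
      `|iter (l j) T (z (i j)) - iter (l' j) T (z (i' j))| + eps j) ->
  L (fun j => `|iter (k j) T (z (n j)) - iter (k' j) T (z (n' j))| ^+ 2) <=
  L (fun j => `|iter (l j) T (z (i j)) - iter (l' j) T (z (i' j))| ^+ 2) +
    (2 * (2 * B) + `|d|) * `|d|.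
Proof.
move=> epsd le; apply: (gen_lim_sqr_le L _ _ _ epsd) => //.
by move=> j; rewrite normr_ge0 orb_dist.
Qed.

(** By polarization the correlation of the increments at distance [h] is a
    combination of squared distances of [z n] to lagged points, at offsets that
    differ from ['C(h.+1, 2)] by multiples of [h]; these distances agree by
    [lag_dist_constant] and cancel. *)
Lemma increment_corr (m h : nat) : (0 < h)%N -> (h %| m)%N ->
  L (fun n => ip (iter m T (z n) - z n)
                 (iter m T (z (n + h)%N) - z (n + h)%N)) <= err m.
Proof.
move=> h0 /dvdnP[k mE]; have [Cz _ oz] := orbz.
pose c := 'C(h.+1, 2).
pose phi o := L (fun n => `|z n - iter (lag h o n) T (z n)| ^+ 2).
pose r n := `|z (n + h)%N - iter (h * n + c) T (z n)|.
have r0 : r @ \oo --> (0 : R) by exact: orbit_shift.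
have phi_cm : phi (c%:Z - m%:Z) = phi c%:Z.
  have := lag_dist_constant orbz h0 (c%:Z - m%:Z) k.
  by rewrite mulnC -mE subrK.
have phi_cp : phi (c%:Z + m%:Z) = phi c%:Z.
  by have := lag_dist_constant orbz h0 c%:Z k; rewrite mulnC -mE.
have phi_ch : phi (c%:Z - h%:Z) = phi c%:Z.
  by have := lag_dist_constant orbz h0 (c%:Z - h%:Z) 1; rewrite muln1 subrK.
have bip (x y : nat -> H) : bounded_seq (fun n => `|x n - y n|) ->
    bounded_seq (fun n => `|x n - y n| ^+ 2) by exact: bounded_seqX.
have rm : (fun n => r n + a m) @ \oo --> a m.
  by rewrite -[X in _ --> X]add0r; apply: cvgD => //; exact: cvg_cst.
have d1 : L (fun n => `|iter m T (z n) - z (n + h)%N| ^+ 2) <= phi c%:Z + err m.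
  rewrite -phi_cm.
  apply: (@dist_le (fun=> m) id (fun=> 0%N) (addn^~ h)
     (fun=> 0%N) id (lag h (c%:Z - m%:Z)) id _ _ rm).
  exists m => // n /= mn.
  have lagE : (h * n + c = m + lag h (c%:Z - m%:Z) n)%N.
    have hn : (n <= h * n)%N by exact: leq_pmull.
    by rewrite /lag; lia.
  have := T_near m (Cz n) (iter_C (lag h (c%:Z - m%:Z) n) (Cz n)).
  rewrite -iterD -lagE => h1.
  rewrite -[X in `|X|](subrKA (iter (h * n + c) T (z n))).
  rewrite (le_trans (ler_normD _ _))//.
  by rewrite /r [X in _ <= _ + (X + _)]distrC; lra.
have d2 : L (fun n => `|z n - iter m T (z (n + h)%N)| ^+ 2) <= phi c%:Z + err m.
  rewrite -phi_cp.
  apply: (@dist_le (fun=> 0%N) id (fun=> m) (addn^~ h)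
     (fun=> 0%N) id (lag h (c%:Z + m%:Z)) id _ _ rm).
  apply: nearW => n /=.
  have -> : lag h (c%:Z + m%:Z) n = (m + (h * n + c))%N by rewrite /lag; lia.
  have := T_near m (Cz (n + h)%N) (iter_C (h * n + c) (Cz n)).
  rewrite -iterD => h1.
  rewrite -[X in `|X|](subrKA (iter (m + (h * n + c)) T (z n))).
  rewrite (le_trans (ler_normD _ _))//.
  by rewrite [X in _ + X <= _]distrC /r; lra.
have d4 : phi c%:Z <= L (fun n => `|z n - z (n + h)%N| ^+ 2).
  have := @dist_le (fun=> 0%N) id (lag h c%:Z) id
     (fun=> 0%N) id (fun=> 0%N) (addn^~ h) _ _ r0.
  rewrite normr0 mulr0 addr0; apply.
  apply: nearW => n /=.
  have -> : lag h c%:Z n = (h * n + c)%N by rewrite /lag; lia.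
  rewrite -[X in `|X|](subrKA (z (n + h)%N)).
  by rewrite (le_trans (ler_normD _ _)).
have d3 : phi c%:Z <=
    L (fun n => `|iter m T (z n) - iter m T (z (n + h)%N)| ^+ 2).
  rewrite -phi_ch /phi -gen_limS; last exact: bip (bdist (fun=> 0%N) id _ id).
  pose dz n := `|z n.+1 - iter n.+1 T (z n)|.
  pose eps n := dz n + (dz n + a (h * n + c)) + (r n + a n.+1) + a (n.+1 - m)%N.
  have eps0 : eps @ \oo --> (0 : R).
    rewrite -[X in _ --> X](_ : 0 + (0 + 0) + (0 + 0) + 0 = 0); last first.
      by rewrite !addr0.
    apply: cvgD.
      apply: cvgD; first apply: cvgD => //.
        apply: cvgD => //; apply: (@cvg_error (fun n => h * n + c)%N).
        apply: (@cvg_nat_infty _ 0%N); apply: nearW => n.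
        by have : (n <= h * n)%N; [exact: leq_pmull|lia].
      apply: cvgD => //; apply: (@cvg_error S).
      by apply: (@cvg_nat_infty _ 0%N); apply: nearW => n; lia.
    apply: (@cvg_error (fun n => n.+1 - m)%N).
    by apply: (@cvg_nat_infty _ m); apply: nearW => n; lia.
  have := @dist_le (fun=> 0%N) S (fun n => lag h (c%:Z - h%:Z) n.+1) S
     (fun=> m) id (fun=> m) (addn^~ h) _ _ eps0.
  rewrite normr0 mulr0 addr0; apply.
  exists m => // n /= mn.
  have -> : lag h (c%:Z - h%:Z) n.+1 = (h * n + c)%N.
    by rewrite /lag mulnS; lia.
  set j := (h * n + c)%N.
  have h1 := T_near j (Cz n.+1) (iter_C n.+1 (Cz n)).
  have h2 := T_near n.+1 (Cz (n + h)%N) (iter_C j (Cz n)).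
  have h3 := T_near (n.+1 - m) (iter_C m (Cz n)) (iter_C m (Cz (n + h)%N)).
  move: h1 h2 h3; rewrite -!iterD subnK; last by lia.
  rewrite addnC => h1 h2 h3.
  pose s1 := z n.+1 - iter n.+1 T (z n).
  pose s2 := iter n.+1 T (z n) - iter n.+1 T (z (n + h)%N).
  pose s3 := iter n.+1 T (z (n + h)%N) - iter (n.+1 + j) T (z n).
  pose s4 := iter j T (z n.+1) - iter (n.+1 + j) T (z n).
  have -> : z n.+1 - iter j T (z n.+1) = s1 + s2 + s3 - s4.
    by rewrite /s1 /s2 /s3 /s4 opprB !subrKA.
  have := ler_normB (s1 + s2 + s3) s4.
  have := ler_normD (s1 + s2) s3; have := ler_normD s1 s2.
  rewrite /eps /r /dz -/s1; move: h1 h2 h3; rewrite -/s2 -/s3 -/s4 -/j -/s1.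
  lra.
have b k n k' n' := bip _ _ (bdist k n k' n').
have b1 := b (fun=> m) id (fun=> 0%N) (addn^~ h).
have b2 := b (fun=> 0%N) id (fun=> m) (addn^~ h).
have b3 := b (fun=> m) id (fun=> m) (addn^~ h).
have b4 := b (fun=> 0%N) id (fun=> 0%N) (addn^~ h).
have -> : L (fun n => ip (iter m T (z n) - z n)
                 (iter m T (z (n + h)%N) - z (n + h)%N)) = 2^-1 *
   (L (fun n => `|iter m T (z n) - z (n + h)%N| ^+ 2) +
    L (fun n => `|z n - iter m T (z (n + h)%N)| ^+ 2) -
    L (fun n => `|iter m T (z n) - iter m T (z (n + h)%N)| ^+ 2) -
    L (fun n => `|z n - z (n + h)%N| ^+ 2)).
  rewrite -(gen_limD L b1 b2) -(gen_limB L (bounded_seqD b1 b2) b3).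
  rewrite -(gen_limB L (bounded_seqB (bounded_seqD b1 b2) b3) b4).
  rewrite -gen_limZ; last first.
    exact: bounded_seqB (bounded_seqB (bounded_seqD b1 b2) b3) b4.
  congr (L _); apply/funext => n.
  by apply: (@mulfI _ 2) => //; rewrite (ip_polar ip_norm) mulrA divff// mul1r.
lra.
Qed.

Lemma increment_sum_corr (m : nat) (N i : nat) :
    (forall h, (i < h <= i + N)%N -> (h %| m)%N) ->
  L (fun n => ip (iter m T (z n) - z n)
    (\sum_(j < N) (iter m T (z (n + (i.+1 + j))%N) - z (n + (i.+1 + j))%N))) <=
  N%:R * err m.
Proof.
have [Cz _ _] := orbz.
have bu k : bounded_seq (fun n => iter m T (z (n + k)%N) - z (n + k)%N).
  by exists (2 * B) => n; exact: (orb_dist m _ 0).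
have bu0 : bounded_seq (fun n => iter m T (z n) - z n).
  by exists (2 * B) => n; exact: (orb_dist m _ 0).
have bsum N' i' : bounded_seq (fun n => \sum_(j < N')
    (iter m T (z (n + (i' + j))%N) - z (n + (i' + j))%N)).
  elim: N' => [|N' IHN].
    by exists 0 => n; rewrite big_ord0 normr0.
  by under eq_fun do rewrite big_ord_recr /=; exact: bounded_seqD.
elim: N => [|N IH] div.
  rewrite mul0r; under eq_fun do rewrite big_ord0 ip0r.
  by rewrite gen_lim_cst.
under eq_fun do rewrite big_ord_recr /= ipDr.
rewrite (gen_limD L (bounded_seq_ip ip_norm bu0 (bsum N i.+1))
  (bounded_seq_ip ip_norm bu0 (bu (i.+1 + N)%N))).
rewrite -natr1 mulrDl mul1r lerD//.
  by apply: IH => h hi; apply: div; lia.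
by apply: increment_corr; [lia|apply: div; lia].
Qed.

(** The increments [iter m T (z n) - z n] are nearly uncorrelated over [N]
    consecutive indices when [m] is a common multiple of the distances, so that
    the norm of their sum grows only like the square root of [N]. *)
Lemma increment_sum_norm (m N : nat) :
    (forall h, (0 < h < N)%N -> (h %| m)%N) ->
  L (fun n => `|\sum_(j < N) (iter m T (z (n + j)%N) - z (n + j)%N)| ^+ 2) <=
  N%:R * (2 * B) ^+ 2 + 2 * N%:R ^+ 2 * err m.
Proof.
have bsum N' i' : bounded_seq (fun n => \sum_(j < N')
    (iter m T (z (n + (i' + j))%N) - z (n + (i' + j))%N)).
  elim: N' => [|N' IHN].
    by exists 0 => n; rewrite big_ord0 normr0.
  under eq_fun do rewrite big_ord_recr /=; apply: bounded_seqD => //.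
  by exists (2 * B) => n; exact: (orb_dist m _ 0).
have bu0 : bounded_seq (fun n => iter m T (z n) - z n).
  by exists (2 * B) => n; exact: (orb_dist m _ 0).
have err0 : 0 <= err m by rewrite mulr_ge0 ?addr_ge0 ?mulr_ge0.
elim: N => [|N IH] div.
  under eq_fun do rewrite big_ord0 normr0 expr0n /=.
  by rewrite gen_lim_cst mul0r expr0n/= mulr0 mul0r addr0.
have {}IH := IH (fun h hN => div h ltac:(lia)).
have b1 : bounded_seq (fun n => `|iter m T (z n) - z n| ^+ 2).
  exact/bounded_seqX/bounded_seq_norm.
have b2 : bounded_seq (fun n => ip (iter m T (z n) - z n)
    (\sum_(j < N) (iter m T (z (n + (1 + j))%N) - z (n + (1 + j))%N))).
  exact: bounded_seq_ip.
have b3 : bounded_seq (fun n =>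
    `|\sum_(j < N) (iter m T (z (n + (1 + j))%N) - z (n + (1 + j))%N)| ^+ 2).
  exact/bounded_seqX/bounded_seq_norm.
have b2' : bounded_seq (fun n => 2 * ip (iter m T (z n) - z n)
    (\sum_(j < N) (iter m T (z (n + (1 + j))%N) - z (n + (1 + j))%N))).
  by apply: bounded_seqM => //; exact: bounded_seq_cst.
rewrite (_ : (fun n => _) = (fun n => `|iter m T (z n) - z n| ^+ 2 +
   2 * ip (iter m T (z n) - z n)
    (\sum_(j < N) (iter m T (z (n + (1 + j))%N) - z (n + (1 + j))%N)) +
   `|\sum_(j < N) (iter m T (z (n + (1 + j))%N) - z (n + (1 + j))%N)| ^+ 2));
   last first.
  by apply/funext => n; rewrite big_ord_recl /= addn0 (norm_sqrD ip_norm).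
rewrite (gen_limD L (bounded_seqD b1 b2') b3) (gen_limD L b1 b2') (gen_limZ L _ b2).
have h1 : L (fun n => `|iter m T (z n) - z n| ^+ 2) <= (2 * B) ^+ 2.
  apply: gen_lim_le_cst => // n.
  by rewrite lerXn2r ?nnegrE//; [exact: mulr_ge0|exact: (orb_dist m _ 0)].
have h2 := @increment_sum_corr m N 0 (fun h hN => div h ltac:(lia)).
have h3 : L (fun n =>
    `|\sum_(j < N) (iter m T (z (n + (1 + j))%N) - z (n + (1 + j))%N)| ^+ 2) <=
    N%:R * (2 * B) ^+ 2 + 2 * N%:R ^+ 2 * err m.
  rewrite -gen_limS in IH; last first.
    exact/bounded_seqX/bounded_seq_norm/(bsum N 0%N).
  apply: le_trans IH; rewrite le_eqVlt; apply/orP; left; apply/eqP.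
  congr (L _); apply/funext => n.
  by under eq_bigr do rewrite addnA addn1.
have N0 : 0 <= N%:R :> R by [].
rewrite -natr1.
move: h1 h2 h3; rewrite -/(err m).
set X1 := L _; set X2 := L _; set X3 := L _; set n := N%:R in N0 *.
have : 0 <= n * err m by exact: mulr_ge0.
set E := err m in err0 *; set b := (2 * B) ^+ 2; nra.
Qed.

(** The mean is the same for the sum of [K ^ 2] increments divided by [K ^ 2],
    and Young's inequality with the weight [K] balances the two terms. *)
Lemma increment_mean_le (m K : nat) (w : H) : (0 < K)%N -> `|w| <= B ->
    (forall h, (0 < h < K ^ 2)%N -> (h %| m)%N) ->
  2 * L (fun n => ip (iter m T (z n) - z n) w) <=
  5 * B ^+ 2 / K%:R + 2 * K%:R * err m.
Proof.
move=> K0 wB div.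
have bu k : bounded_seq (fun n => iter m T (z (n + k)%N) - z (n + k)%N).
  by exists (2 * B) => n; exact: (orb_dist m _ 0).
have bu0 : bounded_seq (fun n => iter m T (z n) - z n).
  by exists (2 * B) => n; exact: (orb_dist m _ 0).
have bsum N : bounded_seq (fun n => \sum_(j < N)
    (iter m T (z (n + j)%N) - z (n + j)%N)).
  elim: N => [|N IHN].
    by exists 0 => n; rewrite big_ord0 normr0.
  by under eq_fun do rewrite big_ord_recr /=; exact: bounded_seqD.
have bw := @bounded_seq_cst R H w.
have sumE N : L (fun n => ip (\sum_(j < N)
      (iter m T (z (n + j)%N) - z (n + j)%N)) w) =
    N%:R * L (fun n => ip (iter m T (z n) - z n) w).
  elim: N => [|N IH].
    by under eq_fun do rewrite big_ord0 ip0l; rewrite gen_lim_cst mul0r.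
  under eq_fun do rewrite big_ord_recr /= ipDl.
  rewrite (gen_limD L (bounded_seq_ip ip_norm (bsum N) bw)
    (bounded_seq_ip ip_norm (bu N) bw)).
  rewrite IH -natr1 mulrDl mul1r; congr (_ + _).
  exact: (gen_lim_shift L N (bounded_seq_ip ip_norm bu0 bw)).
have k0 : 0 < K%:R :> R by rewrite ltr0n.
have hs := increment_sum_norm div.
set e := L _; pose S n := \sum_(j < K ^ 2) (iter m T (z (n + j)%N) - z (n + j)%N).
have bS2 : bounded_seq (fun n => `|S n| ^+ 2).
  exact/bounded_seqX/bounded_seq_norm/bsum.
have bS : bounded_seq (fun n => ip (S n) w).
  by apply: bounded_seq_ip => //; exact: bsum.
have bSK : bounded_seq (fun n => K%:R^-1 * `|S n| ^+ 2).
  by apply: bounded_seqM => //; exact: bounded_seq_cst.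
have : L (fun n => 2 * ip (S n) w) <=
    L (fun n => K%:R^-1 * `|S n| ^+ 2 + K%:R * B ^+ 2).
  apply: gen_lim_le_all.
  - by apply: bounded_seqM => //; exact: bounded_seq_cst.
  - by apply: bounded_seqD => //; exact: bounded_seq_cst.
  move=> n; rewrite (le_trans (ip_young ip_norm _ _ k0))// mulrC lerD2l.
  by rewrite ler_pM2l// lerXn2r ?nnegrE.
have bKB := @bounded_seq_cst R R (K%:R * B ^+ 2).
rewrite (gen_limZ L _ bS) (gen_limD L bSK bKB) (gen_limZ L _ bS2) gen_lim_cst.
rewrite sumE -/e => le1.
have le2 : K%:R^-1 * L (fun n => `|S n| ^+ 2) <=
    K%:R * (2 * B) ^+ 2 + 2 * K%:R ^+ 3 * err m.
  rewrite ler_pdivrMl//; apply: le_trans hs _.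
  by rewrite natrX; rewrite le_eqVlt; apply/orP; left; apply/eqP; ring.
rewrite -(@ler_pM2l _ (K%:R ^+ 2)) ?exprn_gt0//.
have -> : K%:R ^+ 2 * (5 * B ^+ 2 / K%:R + 2 * K%:R * err m) =
   5 * B ^+ 2 * K%:R + 2 * K%:R ^+ 3 * err m by field; rewrite gt_eqF.
move: le1 le2; rewrite natrX.
by set X := K%:R^-1 * _; lra.
Qed.

(** Applying [iter m T] hardly increases the mean squared distance of [z n] to
    [q], nor does it decrease the one to the fixed point [p], by transport.
    Expanding both around [p] leaves the mean of the increments. *)
Lemma mean_iter_le (m : nat) :
  `|iter m T q - q| ^+ 2 <=
  err m + 2 * L (fun n => ip (iter m T (z n) - z n) (iter m T q - p)).
Proof.
have [Cz bz _] := orbz.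
pose y := iter m T q.
have bzp : bounded_seq (fun n => z n - p).
  by exists B => n; exact: (orbB 0).
have bTz : bounded_seq (fun n => iter m T (z n) - p) by exists B.
have bip (w : H) (x : H^nat) : bounded_seq x -> bounded_seq (fun n => ip (x n) w).
  by move=> bx; apply: bounded_seq_ip => //; exact: bounded_seq_cst.
have bsq (x : H^nat) : bounded_seq x -> bounded_seq (fun n => `|x n| ^+ 2).
  by move=> bx; apply/bounded_seqX/bounded_seq_norm.
have zp w : L (fun n => ip (z n - p) w) = ip (q - p) w.
  rewrite ipDl ipNl -qP; under eq_fun do rewrite ipDl.
  rewrite gen_limD ?gen_lim_cst ?ipNl//; first exact: bip.
  exact: bounded_seq_cst.
have center (x : H^nat) w : bounded_seq (fun n => x n - p) ->
    L (fun n => `|x n - w| ^+ 2) = L (fun n => `|x n - p| ^+ 2) -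
      2 * L (fun n => ip (x n - p) (w - p)) + `|w - p| ^+ 2.
  move=> bx; have b1 := bsq _ bx; have b2 := bip (w - p) _ bx.
  have b3 : bounded_seq (fun n => 2 * ip (x n - p) (w - p)).
    by apply: bounded_seqM => //; exact: bounded_seq_cst.
  rewrite -(gen_limZ L _ b2) -(gen_limB L b1 b3).
  rewrite -[X in _ + X](gen_lim_cst L) -gen_limD; last first.
  - exact: bounded_seq_cst.
  - exact: bounded_seqB.
  congr (L _); apply/funext => n.
  by rewrite -(norm_sqrB ip_norm) opprB subrKA.
have h1 : L (fun n => `|iter m T (z n) - y| ^+ 2) <=
    L (fun n => `|z n - q| ^+ 2) + err m.
  have am : (fun=> a m) @ \oo --> a m by exact: cvg_cst.
  have qpB : `|q - p| <= B := qB 0.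
  apply: (gen_lim_sqr_le L _ _ _ am).
  - apply/bounded_seq_norm; have := bounded_seqB bTz (@bounded_seq_cst _ _ (y - p)).
    by under eq_fun do rewrite opprB subrKA.
  - by move=> n; exact: normr_ge0.
  - move=> n; rewrite normr_ge0 -[X in `|X|](subrKA p) (le_trans (ler_normD _ _))//.
    by have := orbB 0 n; rewrite (distrC p) /=; lra.
  - by apply: nearW => n; exact: T_near.
have h2 : L (fun n => `|z n - p| ^+ 2) <= L (fun n => `|iter m T (z n) - p| ^+ 2).
  have := @orbit_transport z (fun=> p) (fun=> 0%N) (fun=> 0%N) (fun=> m)
    (fun=> m) (fun n => n.+1 - m)%N orbz asymp_orbit_fix.
  under [in X in _ -> _ -> _ -> _ -> _ <= X]eq_fun do rewrite iter_fix.
  apply.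
  - by rewrite a_0; exact: cvg_cst.
  - by rewrite a_0; exact: cvg_cst.
  - by apply: (@cvg_nat_infty _ m); apply: nearW => n; lia.
  - by exists m => // n /= mn; split; lia.
move: h1; rewrite center// (center z)//.
have -> : L (fun n => ip (iter m T (z n) - p) (y - p)) =
    L (fun n => ip (iter m T (z n) - z n) (y - p)) + ip (q - p) (y - p).
  rewrite -zp -gen_limD; [|apply: bip|exact: bip]; last first.
    by have := bounded_seqB bTz bzp; under eq_fun do rewrite opprB subrKA.
  by congr (L _); apply/funext => n; rewrite -ipDl subrKA.
rewrite zp => h1.
have -> : y - q = (y - p) - (q - p) by rewrite opprB subrKA.
rewrite (norm_sqrB ip_norm (y - p)) (ipC ip (y - p)).
have := norm_sqr ip_norm (q - p); rewrite -/y; lra.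
Qed.

(** First [K] is chosen, then [m] as a large multiple of [(K ^ 2)`!]. *)
Lemma mean_approx_fixed (e : R) (M : nat) : 0 < e ->
  exists2 m, (M <= m)%N & `|iter m T q - q| ^+ 2 <= e.
Proof.
move=> e0.
have [K K0 KP] : exists2 K, (0 < K)%N & 5 * B ^+ 2 / K%:R <= e / 2.
  have e20 : 0 < e / 2 by rewrite divr_gt0.
  have x0 : 0 <= 5 * B ^+ 2 / (e / 2).
    by rewrite divr_ge0 ?(ltW e20)// mulr_ge0 ?sqr_ge0.
  have := archi_boundP x0; set k := Num.bound _ => kP.
  have k0 : 0 < k%:R :> R by exact: le_lt_trans kP.
  exists k; first by rewrite -(ltr0n R).
  by rewrite ler_pdivrMr// [leRHS]mulrC ltW// -ltr_pdivrMr.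
have erre : (fun m => (1 + 2 * K%:R) * err m) @ \oo --> (0 : R).
  apply: cvg0Zl.
  have na : (fun m => `|a m|) @ \oo --> (0 : R).
    apply: cvg0_le => d d0; apply: filterS (cvg0_near a_cvg0 d0) => m.
    by rewrite normr_id.
  rewrite (_ : err = fun m => 2 * (2 * B) * `|a m| + `|a m| * `|a m|).
    by apply: cvg0D; [exact: cvg0Zl|exact: cvg0M].
  by apply/funext => m; rewrite /err mulrDl.
have e20 : 0 < e / 2 by rewrite divr_gt0.
have [N _ NP] := cvg0_near erre e20.
pose m := ((K ^ 2)`! * maxn M N)%N.
have mM : (maxn M N <= m)%N by rewrite leq_pmull// fact_gt0.
exists m; first by rewrite (leq_trans _ mM)// leq_maxl.
have div h : (0 < h < K ^ 2)%N -> (h %| m)%N.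
  by move=> h0; rewrite dvdn_mulr// dvdn_fact//; lia.
apply: le_trans (mean_iter_le m) _.
have := increment_mean_le K0 (qB m) div.
have := NP m; rewrite /= (leq_trans _ mM) ?leq_maxr// => /(_ isT).
by move=> /(le_trans (ler_norm _)); lra.
Qed.

End Mean.

End Transport.

(** * Fixed points and the variational inequality *)

Section FixedPoints.
Context {R : realType} {H : completeNormedModType R}.
Variable ip : {dot H for idfun}.
Hypothesis ip_norm : induces_norm ip.
Variables (C : set H) (T : H -> H).
Hypothesis T_demi : demicontinuous ip C T.

Lemma cvg_norm_sqr (u : H^nat) (x : H) (e : R^nat) : e @ \oo --> (0 : R) ->
  (\forall n \near \oo, `|u n - x| ^+ 2 <= e n) -> u @ \oo --> x.
Proof.
move=> e0 ue; apply/cvgrPdist_le => d d0.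
have d2 : 0 < d ^+ 2 by rewrite exprn_gt0.
apply: filterS2 ue (cvg0_near e0 d2) => n un en.
rewrite distrC -(@ler_pXn2r _ 2)// ?nnegrE ?(ltW d0)//.
by rewrite (le_trans un)// (le_trans (ler_norm _)).
Qed.

(** Strong limits are weak limits, and weak limits are unique. *)
Lemma demiclosed (u : H^nat) (x y : H) : (forall n, C (u n)) -> C x ->
  u @ \oo --> x -> (fun n => T (u n)) @ \oo --> y -> T x = y.
Proof.
move=> Cu Cx ux Tuy; apply: (ip_ext ip_norm) => w.
apply: (@cvg_unique _ _ ((fun n => ip (T (u n)) w) @ \oo)) => //.
  exact: (T_demi Cu Cx ux).
exact: (cvg_weakly ip_norm Tuy).
Qed.

Lemma Fix_closed : closed C -> closed (Fix C T).
Proof.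
move=> clC x clx.
have [u Fu ux] : exists2 u : H^nat, (forall n, Fix C T (u n)) & u @ \oo --> x.
  have ex n : exists y, Fix C T y /\ `|x - y| < n.+1%:R^-1.
    have [y [Fy xy]] := clx _ (nbhsx_ballx x n.+1%:R^-1 ltac:(by rewrite invr_gt0)).
    by exists y; split=> //; rewrite -ball_normE in xy.
  exists (fun n => xget x [set y | Fix C T y /\ `|x - y| < n.+1%:R^-1]) => [n|].
    exact: (xgetPex x (ex n)).1.
  apply/cvgrPdist_le => e e0.
  apply: filterS (cvg0_near (@cvg_harmonic R) e0) => n he.
  apply: le_trans (ltW (xgetPex x (ex n)).2) _.
  exact: le_trans (ler_norm _) he.
have Cx : C x by apply: (closed_seq_lim clC _ ux) => n; exact: (Fu n).1.
split=> //; apply: (demiclosed _ Cx ux) => [n|]; first exact: (Fu n).1.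
by rewrite (_ : (fun n => T (u n)) = u)//; apply/funext => n; exact: (Fu n).2.
Qed.

Variable a : R^nat.
Hypothesis T_C : forall x, C x -> C (T x).
Hypothesis a_ge0 : forall k, 0 <= a k.
Hypothesis a_cvg0 : a @ \oo --> (0 : R).
Hypothesis T_near : forall k x y, C x -> C y ->
  `|iter k T x - iter k T y| <= `|x - y| + a k.

(** The iterates of a point between two fixed points are asymptotically not
    farther from either of them than the point itself, which by strict convexity
    makes them converge to that point. *)
Lemma Fix_convex : convex_set (C : set (convex_lmodType H)) ->
  convex_set (Fix C T : set (convex_lmodType H)).
Proof.
move=> /convex_setP convC; apply/convex_setP => x y l l01 [Cx Tx] [Cy Ty].
set w := _ + _; have Cw : C w by exact: convC.
have Cit k : C (iter k T w) by exact: iter_C.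
have itx k : iter k T x = x by exact: iter_fix.
have ity k : iter k T y = y by exact: iter_fix.
have /andP[l0 l1] := l01; have l1' : 0 <= 1 - l by lra.
have lE (u : H) : u = l *: u + (1 - l) *: u.
  by rewrite -scalerDl addrC subrK scale1r.
pose D := `|x - y|.
have wx : `|w - x| = (1 - l) * D.
  rewrite (_ : w - x = (1 - l) *: (y - x)) ?normrZ ?ger0_norm 1?distrC//.
  by rewrite [in LHS](lE x) opprD addrACA subrr add0r -scalerBr.
have wy : `|w - y| = l * D.
  rewrite (_ : w - y = l *: (x - y)) ?normrZ ?ger0_norm//.
  by rewrite [in LHS](lE y) opprD addrACA subrr addr0 -scalerBr.
have near0 : (fun k => D * a k + a k ^+ 2) @ \oo --> (0 : R).
  rewrite -[X in _ --> X](_ : D * 0 + 0 * 0 = 0); last by rewrite !mulr0 addr0.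
  by apply: cvgD; apply: cvgM => //; exact: cvg_cst.
have itw : (fun k => iter k T w) @ \oo --> w.
  apply: (cvg_norm_sqr near0); apply: nearW => k.
  have -> : iter k T w - w = l *: (iter k T w - x) + (1 - l) *: (iter k T w - y).
    by rewrite [in LHS](lE (iter k T w)) opprD addrACA -!scalerBr.
  rewrite (norm_sqr_convex ip_norm).
  rewrite (_ : iter k T w - x - _ = y - x); last by rewrite opprB addrC subrKA.
  rewrite (distrC y) -/D.
  have := T_near k Cw Cx; have := T_near k Cw Cy; rewrite itx ity wx wy.
  have D0 : 0 <= D by exact: normr_ge0.
  have := normr_ge0 (iter k T w - x); have := normr_ge0 (iter k T w - y).
  set X := `|iter k T w - x|; set Y := `|_ - y|; move: (a k) (a_ge0 k) => c c0.
  move=> Y0 X0 Yle Xle.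
  have X2 : X ^+ 2 <= ((1 - l) * D + c) ^+ 2 by rewrite lerXn2r ?nnegrE//; lra.
  have Y2 : Y ^+ 2 <= (l * D + c) ^+ 2 by rewrite lerXn2r ?nnegrE//; lra.
  have : l * X ^+ 2 + (1 - l) * Y ^+ 2 <=
      l * ((1 - l) * D + c) ^+ 2 + (1 - l) * (l * D + c) ^+ 2.
    by rewrite lerD// ler_wpM2l.
  have : 0 <= D * c * (1 - 2 * l) ^+ 2 by rewrite mulr_ge0 ?sqr_ge0// mulr_ge0.
  lra.
split=> //; apply: (demiclosed Cit Cw itw).
by rewrite (cvg_shiftS (fun k => iter k T w)).
Qed.

End FixedPoints.

Section VariationalInequality.
Context {R : realType} {H : completeNormedModType R}.
Variable ip : {dot H for idfun}.
Hypothesis ip_norm : induces_norm ip.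

Lemma metric_proj_dist (C : set H) (u v : H) :
    closed C -> C !=set0 -> convex_set (C : set (convex_lmodType H)) -> C v ->
  `|metric_proj C u - v| ^+ 2 <= ip (u - v) (metric_proj C u - v).
Proof.
move=> clC C0 cC Cv; have [Cp /(_ v Cv)] := metric_projP ip_norm u clC C0 cC.
set P := metric_proj C u => h.
rewrite (norm_sqr ip_norm) -subr_ge0 -ipNl -ipDl.
rewrite (_ : u - v - (P - v) = u - P); last by rewrite opprB subrKA.
by rewrite -(opprB v P) ipNr oppr_ge0.
Qed.

Lemma metric_proj_le (C : set H) (u v : H) :
    closed C -> C !=set0 -> convex_set (C : set (convex_lmodType H)) -> C v ->
  `|metric_proj C u - v| <= `|u - v|.
Proof.
move=> clC C0 cC Cv; have := metric_proj_dist u clC C0 cC Cv.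
have [->|n0] := eqVneq (metric_proj C u - v) 0; first by rewrite normr0.
move=> /le_trans /(_ (ip_le ip_norm _ _)).
by rewrite expr2 ler_pM2r// normr_gt0.
Qed.

Lemma metric_proj_nonexpansive (C : set H) (u v : H) :
    closed C -> C !=set0 -> convex_set (C : set (convex_lmodType H)) ->
  `|metric_proj C u - metric_proj C v| <= `|u - v|.
Proof.
move=> clC C0 cC.
have [Cu uP] := metric_projP ip_norm u clC C0 cC.
have [Cv vP] := metric_projP ip_norm v clC C0 cC.
set P := metric_proj C u in Cu uP *; set Q := metric_proj C v in Cv vP *.
have [->|n0] := eqVneq (P - Q) 0; first by rewrite normr0.
have : `|P - Q| ^+ 2 <= `|u - v| * `|P - Q|.
  apply: le_trans (ip_le ip_norm _ _).
  have := uP _ Cv; have := vP _ Cu; rewrite (norm_sqr ip_norm) !ip_lin; lra.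
by rewrite expr2 ler_pM2r// normr_gt0.
Qed.

(** Solutions are the fixed points of [x |-> metric_proj K (x - t *: A x)], which
    is a contraction for the step [t = kappa / M ^+ 2]. *)
Lemma vi_solution (K : set H) (A : H -> H) (kappa M : R) :
    closed K -> K !=set0 -> convex_set (K : set (convex_lmodType H)) ->
    0 < kappa <= M ->
    (forall x y, K x -> K y -> kappa * `|x - y| ^+ 2 <= ip (A x - A y) (x - y)) ->
    (forall x y, K x -> K y -> `|A x - A y| <= M * `|x - y|) ->
  exists2 x, K x & forall z, K z -> 0 <= ip (A x) (z - x).
Proof.
move=> clK K0 cK /andP[k0 kM] Amono Alip.
have M0 : 0 < M by lra.
pose t := kappa / M ^+ 2.
have t0 : 0 < t by rewrite divr_gt0// exprn_gt0.
pose f x := metric_proj K (x - t *: A x).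
have fK : {homo f : x / K x >-> K x}.
  by move=> x _; have [] := metric_projP ip_norm (x - t *: A x) clK K0 cK.
pose q2 := 1 - kappa ^+ 2 / M ^+ 2.
have q20 : 0 <= q2.
  by rewrite subr_ge0 ler_pdivrMr ?exprn_gt0// mul1r lerXn2r ?nnegrE// ltW.
have q21 : q2 < 1 by rewrite ltrBlDr ltrDl divr_gt0// exprn_gt0.
have ctr x y : K x -> K y -> `|f x - f y| <= Num.sqrt q2 * `|x - y|.
  move=> Kx Ky; apply: le_trans (metric_proj_nonexpansive _ _ clK K0 cK) _.
  rewrite -(@ler_pXn2r _ 2)// ?nnegrE ?mulr_ge0 ?sqrtr_ge0// exprMn sqr_sqrtr//.
  have -> : x - t *: A x - (y - t *: A y) = (x - y) - t *: (A x - A y).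
    by rewrite opprB scalerBr opprB addrACA [- _ + _]addrC addrACA.
  rewrite (norm_sqrB ip_norm (x - y)) normrZ exprMn real_normK ?num_real// ipZr.
  rewrite (ipC ip (x - y)).
  have : `|A x - A y| ^+ 2 <= (M * `|x - y|) ^+ 2.
    by rewrite lerXn2r ?nnegrE ?Alip// mulr_ge0// ltW.
  rewrite exprMn => h; have := Amono x y Kx Ky.
  have : t ^+ 2 * `|A x - A y| ^+ 2 <= t ^+ 2 * (M ^+ 2 * `|x - y| ^+ 2).
    by rewrite ler_pM2l// exprn_gt0.
  have -> : q2 = 1 - 2 * (t * kappa) + t ^+ 2 * M ^+ 2.
    by rewrite /q2 /t; field; rewrite gt_eqF.
  move=> h1 h2.
  have : t * (kappa * `|x - y| ^+ 2) <= t * ip (A x - A y) (x - y).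
    by rewrite ler_pM2l.
  move: h1; set X := `|x - y| ^+ 2; set Y := _ ^+ 2; set I := ip _ _; lra.
have fctr : is_contraction (mkfun_fun fK).
  exists (NngNum (sqrtr_ge0 q2)); split.
    by rewrite /= -sqrtr1 ltr_sqrt.
  by move=> [x y] [/= Kx Ky]; exact: ctr.
have [x Kx xE] := banach_fixed_point fctr clK K0.
exists x => // z Kz.
have [_ /(_ z Kz)] := metric_projP ip_norm (x - t *: A x) clK K0 cK.
rewrite -/(f x) (_ : f x = x)//.
by rewrite addrAC subrr add0r ipNl ipZl oppr_le0 pmulr_rge0.
Qed.

(** Otherwise the projection of [q] would separate it from all [z n]. *)
Lemma gen_lim_mean_mem (L : gen_lim R) (C : set H) (z : H^nat) (q : H) :
    closed C -> convex_set (C : set (convex_lmodType H)) ->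
    (forall n, C (z n)) -> bounded_seq z ->
    (forall w, L (fun n => ip (z n) w) = ip q w) ->
  C q.
Proof.
move=> clC cC Cz bz qP; have C0 : C !=set0 by exists (z 0%N).
have [CP PP] := metric_projP ip_norm q clC C0 cC.
set P := metric_proj C q in CP PP.
suff : `|q - P| ^+ 2 <= 0.
  move=> le0; have : `|q - P| ^+ 2 == 0 by rewrite eq_le le0 sqr_ge0.
  by rewrite sqrf_eq0 normr_eq0 subr_eq0 => /eqP ->.
have b (w : H) : bounded_seq (fun n => ip (z n) w).
  by apply: bounded_seq_ip => //; exact: bounded_seq_cst.
rewrite (norm_sqr ip_norm) ipDl -qP -[ip (- P) _](gen_lim_cst L) -gen_limD//.
  apply: gen_lim_le_cst.
    by apply: bounded_seqD => //; exact: bounded_seq_cst.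
  by move=> n; rewrite -ipDl ipC; exact: PP.
exact: bounded_seq_cst.
Qed.

End VariationalInequality.

(** Along iterates that return to [q], which exist by [mean_approx_fixed],
    asymptotic regularity at [q] makes the next iterates return as well, and
    demiclosedness applies. *)
Lemma gen_lim_mean_fixed (R : realType) (H : completeNormedModType R)
    (ip : {dot H for idfun}) (C : set H) (T : H -> H) (a : R^nat)
    (p : H) (z : H^nat) (L : gen_lim R) (q : H) :
    induces_norm ip -> closed C -> convex_set (C : set (convex_lmodType H)) ->
    (forall x, C x -> C (T x)) -> demicontinuous ip C T ->
    a 0%N = 0 -> a @ \oo --> (0 : R) ->
    (forall k x y, C x -> C y ->
      `|iter k T x - iter k T y| <= `|x - y| + a k) ->
    (forall x, C x ->
      (fun n => `|iter n T x - iter n.-1 T x|) @ \oo --> (0 : R)) ->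
    Fix C T p -> asymp_orbit C T z ->
    (forall w, L (fun n => ip (z n) w) = ip q w) ->
  Fix C T q.
Proof.
move=> ipN clC cC T_C T_demi a_0 a_cvg0 T_near T_reg [Cp Tp] orbz qP.
have [Cz bz _] := orbz.
have Cq : C q by exact: (gen_lim_mean_mem ipN clC cC Cz bz qP).
split=> //.
have itp k : iter k T p = p by exact: iter_fix.
have [M zM] := bz; have [K aK] := bounded_seq_cvg a_cvg0.
have aK' k : a k <= K by exact: le_trans (ler_norm _) (aK k).
pose B := M + `|p| + `|q - p| + K.
have orbB k n : `|iter k T (z n) - p| <= B.
  have := T_near k _ _ (Cz n) Cp; rewrite itp => /le_trans; apply.
  have := ler_normB (z n) p; have := zM n; have := aK' k.
  by have := normr_ge0 (q - p); rewrite /B; lra.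
have M0 : 0 <= M := le_trans (normr_ge0 _) (zM 0%N).
have qB k : `|iter k T q - p| <= B.
  have := T_near k _ _ Cq Cp; rewrite itp => /le_trans; apply.
  by have := aK' k; have := normr_ge0 p; rewrite /B; lra.
have ex k : exists m, (k <= m)%N /\ `|iter m T q - q| ^+ 2 <= k.+1%:R^-1.
  have k0 : 0 < k.+1%:R^-1 :> R by rewrite invr_gt0.
  have [m km mP] := mean_approx_fixed ipN T_C a_0 a_cvg0 T_near Cp Tp
    orbz Cq qP orbB qB k k0.
  by exists m.
have /choice[m mP] := ex.
have mq : (fun k => iter (m k) T q) @ \oo --> q.
  apply: (cvg_norm_sqr (@cvg_harmonic R)); apply: nearW => k.
  exact: (mP k).2.
have Cm k : C (iter (m k) T q) by exact: iter_C.
apply: (demiclosed ipN T_demi Cm Cq mq).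
rewrite (_ : (fun n => _) = (fun k => (iter (m k).+1 T q - iter (m k) T q) +
   iter (m k) T q)); last by apply/funext => k; rewrite subrK.
rewrite -[X in _ --> X](add0r q); apply: cvgD => //.
apply/cvgrPdist_le => e e0.
have [N _ NP] := cvg0_near (T_reg q Cq) e0.
exists N => // k /= Nk; rewrite sub0r normrN.
have := NP (m k).+1; rewrite /= normr_id; apply.
by have := (mP k).1; lia.
Qed.

(** * The projected scheme *)

Section Scheme.
Context {R : realType} {H : completeNormedModType R}.
Variable ip : {dot H for idfun}.
Hypothesis ip_norm : induces_norm ip.
Variable C : set H.
Variables (V F : H -> H) (gamma L eta mu rho : R).
Hypothesis V_lip : forall x y, C x -> C y -> `|V x - V y| <= gamma * `|x - y|.
Hypothesis F_lip : forall x y, C x -> C y -> `|F x - F y| <= L * `|x - y|.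
Hypothesis F_mono : strongly_monotone ip C eta F.
Hypotheses (mu_ge0 : 0 <= mu) (L_ge0 : 0 <= L) (rho_ge0 : 0 <= rho).

(** Strong monotonicity gives the rate [mu * eta] to first order in [al]; the
    second order term is absorbed by the slack [d]. *)
Lemma gradient_step_contract (al d : R) (u w : H) : C u -> C w ->
    0 <= al -> al * (mu ^+ 2 * L ^+ 2) <= 2 * d -> al * (mu * eta - d) <= 1 ->
  `|(u - (al * mu) *: F u) - (w - (al * mu) *: F w)| <=
  (1 - al * (mu * eta - d)) * `|u - w|.
Proof.
move=> Cu Cw al0 ald al1.
rewrite -(@ler_pXn2r _ 2)// ?nnegrE ?mulr_ge0 ?subr_ge0//.
have -> : u - (al * mu) *: F u - (w - (al * mu) *: F w) =
    (u - w) - (al * mu) *: (F u - F w).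
  by rewrite opprB scalerBr opprB addrACA [- _ + _]addrC addrACA.
rewrite (norm_sqrB ip_norm (u - w)) normrZ !exprMn real_normK ?num_real// ipZr.
rewrite (ipC ip (u - w)).
have h1 : `|F u - F w| ^+ 2 <= L ^+ 2 * `|u - w| ^+ 2.
  by rewrite -exprMn lerXn2r ?nnegrE ?F_lip// mulr_ge0.
have h2 := F_mono Cu Cw; set k := mu * eta - d.
have h3 : (al * mu) ^+ 2 * `|F u - F w| ^+ 2 <=
    (al * mu) ^+ 2 * (L ^+ 2 * `|u - w| ^+ 2) by rewrite ler_wpM2l ?sqr_ge0.
have h4 : al * mu * (eta * `|u - w| ^+ 2) <= al * mu * ip (F u - F w) (u - w).
  by rewrite ler_wpM2l// mulr_ge0.
have h5 : al * `|u - w| ^+ 2 * (al * (mu ^+ 2 * L ^+ 2)) <=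
    al * `|u - w| ^+ 2 * (2 * d) by rewrite ler_wpM2l// mulr_ge0// sqr_ge0.
have h6 : 0 <= (al * k) ^+ 2 * `|u - w| ^+ 2 by rewrite mulr_ge0 ?sqr_ge0.
move: h3 h4 h5 h6; rewrite /k.
set X := `|u - w| ^+ 2; set Y := `|_| ^+ 2; set I := ip _ _; lra.
Qed.

Hypothesis C_closed : closed C.
Hypothesis C_convex : convex_set (C : set (convex_lmodType H)).

Lemma vi_operator_mono (u w : H) : C u -> C w ->
  (mu * eta - rho * gamma) * `|u - w| ^+ 2 <=
  ip ((mu *: F u - rho *: V u) - (mu *: F w - rho *: V w)) (u - w).
Proof.
move=> Cu Cw.
have -> : (mu *: F u - rho *: V u) - (mu *: F w - rho *: V w) =
    mu *: (F u - F w) - rho *: (V u - V w).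
  by apply: (ip_ext ip_norm) => r; rewrite !ip_lin; ring.
rewrite ipDl ipNl !ipZl.
have h1 : mu * (eta * `|u - w| ^+ 2) <= mu * ip (F u - F w) (u - w).
  by rewrite ler_wpM2l//; exact: F_mono.
have h2 : rho * ip (V u - V w) (u - w) <= rho * (gamma * `|u - w| ^+ 2).
  rewrite ler_wpM2l// (le_trans (ip_le ip_norm _ _))// expr2 mulrA.
  by rewrite ler_wpM2r// V_lip.
by lra.
Qed.

Lemma vi_operator_lip (u w : H) : C u -> C w ->
  `|(mu *: F u - rho *: V u) - (mu *: F w - rho *: V w)| <=
  (mu * L + rho * gamma) * `|u - w|.
Proof.
move=> Cu Cw.
have -> : (mu *: F u - rho *: V u) - (mu *: F w - rho *: V w) =
    mu *: (F u - F w) - rho *: (V u - V w).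
  by apply: (ip_ext ip_norm) => r; rewrite !ip_lin; ring.
rewrite (le_trans (ler_normB _ _))// !normrZ !ger0_norm//.
have h1 : mu * `|F u - F w| <= mu * (L * `|u - w|) by rewrite ler_wpM2l// F_lip.
have h2 : rho * `|V u - V w| <= rho * (gamma * `|u - w|).
  by rewrite ler_wpM2l// V_lip.
lra.
Qed.

(** The perturbed step is split into the part coming from [V], the gradient step
    at [w], and the constant drift [al *: (rho *: V xs - mu *: F xs)]; only the
    inner product with the drift is kept. *)
Lemma projected_step (al d e : R) (x w xs : H) : C x -> C w -> C xs ->
    0 <= al -> al * (mu ^+ 2 * L ^+ 2) <= 2 * d -> al * (mu * eta - d) <= 1 ->
    `|w - xs| <= `|x - xs| + e -> 0 <= e -> d <= mu * eta ->
  let x' := metric_proj C ((al * rho) *: V x + (w - (al * mu) *: F w)) in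
  `|x' - xs| ^+ 2 <=
  ((1 - al * (mu * eta - d - rho * gamma)) * `|x - xs| + e) * `|x' - xs| +
  al * ip (rho *: V xs - mu *: F xs) (x' - xs).
Proof.
move=> Cx Cw Cxs al0 ald al1 wx e0 dmu /=; set x' := metric_proj _ _.
have C0 : C !=set0 by exists xs.
apply: (le_trans (metric_proj_dist ip_norm _ C_closed C0 C_convex Cxs)).
pose g := (w - (al * mu) *: F w) - (xs - (al * mu) *: F xs).
have -> : (al * rho) *: V x + (w - (al * mu) *: F w) - xs =
    ((al * rho) *: (V x - V xs) + g) + al *: (rho *: V xs - mu *: F xs).
  by apply: (ip_ext ip_norm) => y; rewrite /g !ip_lin; ring.
rewrite ipDl ipZl lerD2r.
apply: (le_trans (ip_le ip_norm _ _)); rewrite ler_wpM2r//.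
apply: (le_trans (ler_normD _ _)); rewrite normrZ ger0_norm ?mulr_ge0//.
have h1 : al * rho * `|V x - V xs| <= al * rho * (gamma * `|x - xs|).
  by rewrite ler_wpM2l ?mulr_ge0// V_lip.
have h2 := gradient_step_contract Cw Cxs al0 ald al1; rewrite -/g in h2.
have h3 : (1 - al * (mu * eta - d)) * `|w - xs| <=
    (1 - al * (mu * eta - d)) * (`|x - xs| + e).
  by rewrite ler_wpM2l// subr_ge0.
have : 0 <= al * (mu * eta - d) * e by rewrite mulr_ge0// mulr_ge0// subr_ge0.
lra.
Qed.

End Scheme.

Lemma bounded_relaxation (R : realType) (t s : R^nat) (M : R) :
    (forall n, 0 <= s n) ->
    (\forall n \near \oo, 0 <= t n <= 1 /\ s n.+1 <= (1 - t n) * s n + t n * M) ->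
  bounded_seq s.
Proof.
move=> s0 [N _ HN]; apply: (@bounded_seq_near _ _ _ (Num.max (s N) M)).
exists N => // n /= Nn; rewrite ger0_norm// -(subnK Nn).
elim: (n - N)%N => [|k IH]; first by rewrite add0n le_max lexx.
have [] := HN (k + N)%N (leq_addl _ _); rewrite addSn => t01 /le_trans; apply.
have MM : M <= Num.max (s N) M by rewrite le_max lexx orbT.
by move: IH MM; set B := Num.max _ _ => IH MM; nra.
Qed.

Lemma slow_variation (R : realType) (u : R^nat) : (forall n, 0 < u n) ->
  (fun n => `|u n.+1 - u n| / u n.+1) @ \oo --> (0 : R) ->
  (fun n => `|u n.+1 - u n| / u n) @ \oo --> (0 : R).
Proof.
move=> u0 us; apply: cvg0_le => e e0.
have e2 : 0 < Num.min (2^-1) (e / 2) by rewrite lt_min invr_gt0 divr_gt0// ltr0n.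
apply: filterS (cvg0_near us e2) => n.
move=> /(le_trans (ler_norm _)); rewrite le_min !ler_pdivrMr// => /andP[h1 h2].
have := ler_norm (u n.+1 - u n); have := u0 n; have := u0 n.+1 => v1 v0 hn.
have h3 : u n.+1 <= 2 * u n by lra.
rewrite ger0_norm ?divr_ge0 ?(ltW v0)// ler_pdivrMr//.
apply: (le_trans h2); have : e / 2 * u n.+1 <= e / 2 * (2 * u n).
  by rewrite ler_pM2l// divr_gt0.
lra.
Qed.

(** Dividing by [D n.+1] gives a relaxation towards [(1 + W) / k]. *)
Lemma quadratic_step_bounded (R : realType) (al e D : R^nat) (k W : R) :
    0 < k -> 0 <= W -> (forall n, 0 <= D n) ->
    (\forall n \near \oo, [/\ 0 < al n, al n * k <= 1, e n <= al n &
      D n.+1 ^+ 2 <= ((1 - al n * k) * D n + e n) * D n.+1 +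
                     al n * (W * D n.+1)]) ->
  bounded_seq D.
Proof.
move=> k0 W0 D0 step.
apply: (@bounded_relaxation _ (fun n => al n * k) _ ((1 + W) / k)) => //.
apply: filterS step => n [an s1 s2 st].
rewrite mulr_ge0 ?(ltW an) ?(ltW k0)//=; split=> //.
have -> : al n * k * ((1 + W) / k) = al n * (1 + W).
  by rewrite -mulrA [k * _]mulrC divfK// gt_eqF.
have [Dn|Dn] := eqVneq (D n.+1) 0.
  rewrite [leLHS]Dn addr_ge0// mulr_ge0 ?subr_ge0// ?(ltW an)//.
  exact: addr_ge0.
have Dpos : 0 < D n.+1 by rewrite lt_neqAle eq_sym Dn D0.
rewrite -(ler_pM2r Dpos).
have : e n * D n.+1 <= al n * D n.+1 by rewrite ler_pM2r.
by move: st; rewrite expr2; lra.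
Qed.

(** The recurrence bounds the limit superior of [`|z n - xs| ^+ 2] by a
    generalized limit of [ip v (z n - xs)], that is by [ip v (q - xs)] for a
    mean [q] of [z]. Such a mean is a fixed point, where [vi] applies. *)
Lemma viscosity_cvg (R : realType) (H : completeNormedModType R)
    (ip : {dot H for idfun}) (C : set H) (T : H -> H) (a al e : R^nat)
    (xs v : H) (z : H^nat) (k : R) :
    induces_norm ip -> closed C -> convex_set (C : set (convex_lmodType H)) ->
    (forall x, C x -> C (T x)) -> demicontinuous ip C T ->
    a 0%N = 0 -> a @ \oo --> (0 : R) ->
    (forall k x y, C x -> C y ->
      `|iter k T x - iter k T y| <= `|x - y| + a k) ->
    (forall x, C x ->
      (fun n => `|iter n T x - iter n.-1 T x|) @ \oo --> (0 : R)) ->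
    Fix C T xs -> (forall x, Fix C T x -> ip v (x - xs) <= 0) ->
    asymp_orbit C T z ->
    0 < k -> (forall n, 0 < al n <= 1) -> al @ \oo --> (0 : R) ->
    (fun N => \sum_(0 <= n < N) al n) @ \oo --> +oo ->
    (fun n => `|al n.+1 - al n| / al n) @ \oo --> (0 : R) ->
    (forall n, 0 <= e n) -> (fun n => e n / al n) @ \oo --> (0 : R) ->
    (\forall n \near \oo, al n * k <= 1 /\
      `|z n.+1 - xs| ^+ 2 <=
      ((1 - al n * k) * `|z n - xs| + e n) * `|z n.+1 - xs| +
      al n * ip v (z n.+1 - xs)) ->
  z @ \oo --> xs.
Proof.
move=> ipN clC cC T_C T_demi a_0 a_cvg0 T_near T_reg Fxs vi orbz.
move=> k0 al01 al_cvg0 al_sum al_slow e0 ea step.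
have [_ bz _] := orbz.
have al0 n : 0 < al n by have /andP[] := al01 n.
pose D n := `|z n - xs|.
have [B DB'] : bounded_seq D.
  by apply/bounded_seq_norm/bounded_seqB => //; exact: bounded_seq_cst.
have DB n : D n <= B by apply: le_trans (ler_norm _) (DB' n).
pose c := Num.min k 1.
have c0 : 0 < c by rewrite lt_min k0 ltr01.
have [ck c1] : c <= k /\ c <= 1 by rewrite !ge_min !lexx orbT.
pose t n := c * al n.
have t01 n : 0 <= t n <= 1.
  have /andP[h1 h2] := al01 n.
  by rewrite /t mulr_ge0 ?(ltW c0) ?(ltW h1)//= mulr_ile1// ltW.
have t_pos n : 0 < t n by rewrite mulr_gt0.
have t_cvg0 : t @ \oo --> (0 : R) by exact: cvg0Zl.
have t_sum : (fun N => \sum_(0 <= i < N) t i) @ \oo --> +oo.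
  apply/cvgryPge => M; move/cvgryPge : al_sum => /(_ (M / c)).
  apply: filterS => n; rewrite -mulr_sumr => h.
  by rewrite mulrC -ler_pdivrMr.
have t_slow : (fun n => `|t n.+1 - t n| / t n) @ \oo --> (0 : R).
  rewrite [X in X @ _](_ : _ = (fun n => `|al n.+1 - al n| / al n))//.
  apply/funext => n; rewrite /t -mulrBr normrM (gtr0_norm c0).
  by field; rewrite !gt_eqF.
pose b n := 2 / c * (ip v (z n.+1 - xs) + B * (e n / al n)).
have ea' : (fun n => B * (e n / al n)) @ \oo --> (0 : R) by exact: cvg0Zl.
have bv : bounded_seq (fun n => ip v (z n - xs)).
  apply: (bounded_seq_ip ipN (@bounded_seq_cst _ _ v)).
  by apply: bounded_seqB => //; exact: bounded_seq_cst.
have bv1 := bounded_seqS bv.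
have bea := bounded_seq_cvg ea'.
have bb : bounded_seq b.
  by apply: bounded_seqM (bounded_seq_cst _) _; exact: bounded_seqD.
have srec : \forall n \near \oo,
    D n.+1 ^+ 2 <= (1 - t n) * D n ^+ 2 + t n * b n.
  apply: filterS step => n [s1 st]; rewrite -/(D n) -/(D n.+1) in st.
  have -> : t n * b n = 2 * (al n * ip v (z n.+1 - xs) + B * e n).
    by rewrite /t /b; field; rewrite !gt_eqF.
  have h1 : e n * D n.+1 <= e n * B by rewrite ler_wpM2l.
  (* This bounds the mixed product of [D n] and [D n.+1] by their squares. *)
  have h2 : 0 <= (1 - al n * k) * (D n - D n.+1) ^+ 2.
    by rewrite mulr_ge0 ?sqr_ge0// subr_ge0.
  have h3 : 0 <= al n * k * D n.+1 ^+ 2.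
    by rewrite mulr_ge0 ?sqr_ge0// mulr_ge0// ltW.
  have h4 : 0 <= al n * (k - c) * D n ^+ 2.
    by rewrite mulr_ge0 ?sqr_ge0// mulr_ge0 ?subr_ge0// ltW.
  rewrite /t; lra.
suff sq0 : (fun n => D n ^+ 2) @ \oo --> (0 : R).
  by apply: (cvg_norm_sqr sq0); exact: nearW.
apply: cvg0_le => f f0; apply: contrapT => big.
have {}big : ~ \forall n \near \oo, D n ^+ 2 <= f.
  move=> le; apply: big; apply: filterS le => n.
  by rewrite ger0_norm ?sqr_ge0.
have [G fG] := relaxation_gen_lim t01 t_sum t_cvg0 t_pos t_slow bb srec big.
have [q qP] := gen_lim_mean ipN G bz.
have Fq : Fix C T q by exact: (gen_lim_mean_fixed ipN clC cC T_C T_demi a_0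
  a_cvg0 T_near T_reg Fxs orbz qP).
suff : G b <= 0 by move=> /(le_trans fG); rewrite leNgt f0.
rewrite /b gen_limZ; last exact: bounded_seqD.
rewrite (gen_limD G bv1 bea) (gen_lim_cvg G ea') addr0 (gen_limS G bv).
rewrite pmulr_rle0; last by rewrite divr_gt0.
have -> : G (fun n => ip v (z n - xs)) = ip v (q - xs).
  have bzv : bounded_seq (fun n => ip (z n) v).
    exact: (bounded_seq_ip ipN bz (@bounded_seq_cst _ _ v)).
  rewrite ipDr ipNr (ipC ip v q) -qP -[ip v xs](gen_lim_cst G) -gen_limB//.
    by congr (G _); apply/funext => n; rewrite ipDr ipNr (ipC ip v).
  exact: bounded_seq_cst.
exact: vi.
Qed.

(** The radicand is at least [(1 - mu * eta) ^+ 2]. *)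
Lemma contraction_coef_lt (R : realType) (eta L mu c : R) :
    0 <= eta <= L -> 0 <= mu ->
    c < 1 - Num.sqrt (1 - mu * (2 * eta - mu * L ^+ 2)) ->
  c < mu * eta.
Proof.
move=> /andP[eta0 etaL] mu0.
set s := Num.sqrt _; have s0 : 0 <= s by exact: sqrtr_ge0.
have eL : eta ^+ 2 <= L ^+ 2 by rewrite lerXn2r ?nnegrE// (le_trans eta0).
have eL' : mu ^+ 2 * eta ^+ 2 <= mu ^+ 2 * L ^+ 2 by rewrite ler_wpM2l ?sqr_ge0.
have r0 : 0 <= 1 - mu * (2 * eta - mu * L ^+ 2).
  by have := sqr_ge0 (1 - mu * eta); lra.
suff : 1 - mu * eta <= s by lra.
have [neg|pos] := leP (1 - mu * eta) 0; first exact: (le_trans neg).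
rewrite -(@ler_pXn2r _ 2)// ?nnegrE ?(ltW pos)// sqr_sqrtr//; lra.
Qed.

(** Strong monotonicity of rate [eta] forces a Lipschitz constant of at least
    [eta] between distinct points. *)
Lemma lip_strongly_monotone_single (R : realType) (H : completeNormedModType R)
    (ip : {dot H for idfun}) (C : set H) (F : H -> H) (L eta : R) :
    induces_norm ip ->
    (forall x y, C x -> C y -> `|F x - F y| <= L * `|x - y|) ->
    strongly_monotone ip C eta F -> L < eta ->
  forall x y, C x -> C y -> x = y.
Proof.
move=> ipN F_lip F_mono etaL x y Cx Cy.
apply/eqP; rewrite -subr_eq0 -normr_eq0; apply/negPn/negP => n0.
have N0 : 0 < `|x - y| by rewrite lt_neqAle eq_sym n0 normr_ge0.
have h1 := F_mono _ _ Cx Cy.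
have h2 := ip_le ipN (F x - F y) (x - y).
have h3 : `|F x - F y| * `|x - y| <= L * `|x - y| * `|x - y|.
  by rewrite ler_pM2r// F_lip.
have : eta * `|x - y| ^+ 2 <= L * `|x - y| ^+ 2 by rewrite expr2 !mulrA; lra.
by rewrite ler_pM2r ?exprn_gt0//; lra.
Qed.

Theorem theorem2 (R : realType) (H : completeNormedModType R)
    (ip : {dot H for idfun}) (ip_norm : induces_norm ip)
    (C : set H) (C_neq0 : C !=set0) (C_closed : closed C)
    (C_convex : convex_set (C : set (convex_lmodType H)))
    (S T V F : H -> H) (a alpha beta : R^nat) (gamma L eta mu rho : R)
    (S_C : forall x, C x -> C (S x)) (S_nonexp : 1.-lipschitz_C S)
    (T_C : forall x, C x -> C (T x)) (T_demi : demicontinuous ip C T)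
    (a_ge0 : forall n : nat, (1 <= n)%N -> 0 <= a n)
    (a_cvg0 : a @ \oo --> (0 : R))
    (T_nearly : nearly_nonexpansive C a T)
    (FixT_neq0 : Fix C T !=set0)
    (gamma_gt0 : 0 < gamma) (V_lip : gamma.-lipschitz_C V)
    (L_gt0 : 0 < L) (F_lip : L.-lipschitz_C F)
    (eta_gt0 : 0 < eta) (F_mono : strongly_monotone ip C eta F)
    (mu_bounds : 0 < mu < 2 * eta / L ^+ 2)
    (rho_bounds : 0 <= rho * gamma <
                  1 - Num.sqrt (1 - mu * (2 * eta - mu * L ^+ 2)))
    (x y : H^nat) (x1_C : C (x 1%N))
    (yE : forall n : nat, (1 <= n)%N ->
      y n = beta n *: S (x n) + (1 - beta n) *: x n)
    (xE : forall n : nat, (1 <= n)%N ->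
      x n.+1 = metric_proj C
        ((alpha n * rho) *: V (x n)
         + (iter n T (y n) - (alpha n * mu) *: F (iter n T (y n)))))
    (alpha_01 : forall n : nat, (1 <= n)%N -> 0 <= alpha n <= 1)
    (beta_01 : forall n : nat, (1 <= n)%N -> 0 <= beta n <= 1)
    (alpha_neq0 : forall n : nat, (1 <= n)%N -> alpha n != 0)
    (alpha_cvg0 : alpha @ \oo --> (0 : R))
    (alpha_sum : (fun N : nat => \sum_(1 <= n < N) alpha n) @ \oo --> +oo)
    (a_alpha : (fun n : nat => a n / alpha n) @ \oo --> (0 : R))
    (beta_alpha : (fun n : nat => beta n / alpha n) @ \oo --> (0 : R))
    (dalpha_alpha :
      (fun n : nat => `|alpha n - alpha n.-1| / alpha n) @ \oo --> (0 : R))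
    (dbeta_alpha :
      (fun n : nat => `|beta n - beta n.-1| / alpha n) @ \oo --> (0 : R))
    (T_asymp_reg : forall z, C z ->
      (fun n : nat => `|iter n T z - iter n.-1 T z|) @ \oo --> (0 : R))
    (T_asymp_alpha : forall z, C z ->
      (fun n : nat => `|iter n T z - iter n.-1 T z| / alpha n)
        @ \oo --> (0 : R)) :
  exists xs : H,
    [/\ x @ \oo --> xs,
        Fix C T xs,
        forall z, Fix C T z -> ip (rho *: V xs - mu *: F xs) (z - xs) <= 0 &
        forall x' : H, Fix C T x' ->
          (forall z, Fix C T z -> ip (rho *: V x' - mu *: F x') (z - x') <= 0) ->
          x' = xs].
Proof.
have V_lip' u w : C u -> C w -> `|V u - V w| <= gamma * `|u - w|.
  by move=> Cu Cw; exact: (V_lip (u, w) (conj Cu Cw)).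
have F_lip' u w : C u -> C w -> `|F u - F w| <= L * `|u - w|.
  by move=> Cu Cw; exact: (F_lip (u, w) (conj Cu Cw)).
have S_lip u w : C u -> C w -> `|S u - S w| <= `|u - w|.
  by move=> Cu Cw; rewrite -[leRHS]mul1r; exact: (S_nonexp (u, w) (conj Cu Cw)).
have /andP[mu0 _] := mu_bounds; have /andP[rg0 rgnu] := rho_bounds.
have rho0 : 0 <= rho by rewrite -(pmulr_lge0 _ gamma_gt0).
have xC n : C (x n.+1).
  elim: n => // n IH; rewrite xE//.
  by have [] := metric_projP ip_norm ((alpha n.+1 * rho) *: V (x n.+1)
   + (iter n.+1 T (y n.+1) - (alpha n.+1 * mu) *: F (iter n.+1 T (y n.+1))))
   C_closed C_neq0 C_convex.
have [p0 [Cp0 Tp0]] := FixT_neq0.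
(* If [L < eta] then [C] is a single point. *)
have [etaL|etaL] := ltP L eta.
  have single := lip_strongly_monotone_single ip_norm F_lip' F_mono etaL.
  exists p0; split=> //.
  - rewrite -(cvg_shiftS x) [X in X @ _](_ : _ = (fun=> p0)); first exact: cvg_cst.
    by apply/funext => n; exact: (single _ _ (xC n) Cp0).
  - by move=> u [Cu _]; rewrite (single u p0 Cu Cp0) subrr ip0r.
  - by move=> u [Cu _] _; exact: (single _ _ Cu Cp0).
pose k := mu * eta - rho * gamma.
have k0 : 0 < k.
  rewrite subr_gt0; apply: (contraction_coef_lt _ (ltW mu0) rgnu).
  by rewrite (ltW eta_gt0).
(* With [a' 0 = 0] near nonexpansiveness extends to the zeroth iterate. *)
pose a' n := if n is n'.+1 then a n else 0.
have a'E n : (0 < n)%N -> a' n = a n by case: n.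
have a'_ge0 n : 0 <= a' n by case: n => [|n]//=; exact: a_ge0.
have a'_cvg0 : a' @ \oo --> (0 : R).
  by rewrite -(cvg_shiftS a') /a' (cvg_shiftS a).
have T_near n u w : C u -> C w -> `|iter n T u - iter n T w| <= `|u - w| + a' n.
  by case: n => [|n] Cu Cw; [rewrite /= addr0|exact: (T_nearly n.+1)].
have K_closed : closed (Fix C T) by exact: (Fix_closed ip_norm T_demi C_closed).
have K_convex : convex_set (Fix C T : set (convex_lmodType H)).
  exact: (Fix_convex ip_norm T_demi T_C a'_ge0 a'_cvg0 T_near C_convex).
pose A u := mu *: F u - rho *: V u.
have A_mono u w : C u -> C w -> k * `|u - w| ^+ 2 <= ip (A u - A w) (u - w).
  exact: (vi_operator_mono ip_norm V_lip' F_mono (ltW mu0) rho0).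
(* The summand [k] makes the Lipschitz constant exceed the monotonicity. *)
have A_lip u w : C u -> C w ->
    `|A u - A w| <= (mu * L + rho * gamma + k) * `|u - w|.
  move=> Cu Cw; rewrite mulrDl.
  apply: (le_trans (vi_operator_lip ip_norm V_lip' F_lip' (ltW mu0) rho0 Cu Cw)).
  by rewrite lerDl mulr_ge0// ltW.
have kM : 0 < k <= mu * L + rho * gamma + k.
  by rewrite k0/= lerDr addr_ge0// mulr_ge0// ltW.
have [xs [Cxs Txs] xsP] :=
  vi_solution ip_norm K_closed FixT_neq0 K_convex kM
    (fun u w Ku Kw => A_mono u w Ku.1 Kw.1)
    (fun u w Ku Kw => A_lip u w Ku.1 Kw.1).
pose v := rho *: V xs - mu *: F xs.
have vE : v = - A xs by rewrite /v /A opprB.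
have vi z : Fix C T z -> ip v (z - xs) <= 0.
  by move=> Kz; rewrite vE ipNl oppr_le0; exact: xsP.
exists xs; split=> //; last first.
  move=> x' [Cx' Tx'] x'P; apply/eqP; rewrite -subr_eq0 -normr_eq0 -sqrf_eq0.
  have := A_mono _ _ Cx' Cxs; have := x'P xs (conj Cxs Txs).
  have := xsP x' (conj Cx' Tx').
  have -> : rho *: V x' - mu *: F x' = - A x' by rewrite /A opprB.
  rewrite -(opprB x' xs) ipNl ipNr opprK [ip (A x' - _) _]ipDl ipNl => h1 h2 h3.
  have : k * `|x' - xs| ^+ 2 <= 0 by lra.
  by rewrite pmulr_rle0// => h; rewrite eq_le h sqr_ge0.
rewrite -/v in vi.
have al0 n : 0 < alpha n.+1.
  by rewrite lt_neqAle eq_sym alpha_neq0//; have /andP[] := alpha_01 n.+1 isT.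
have al_pos n : (0 < n)%N -> 0 < alpha n by case: n.
have xC' n : (0 < n)%N -> C (x n) by case: n.
have yC n : (0 < n)%N -> C (y n).
  move=> n0; rewrite yE//; have /convex_setP convC := C_convex.
  by apply: convC; [exact: beta_01|exact/S_C/xC'|exact: xC'].
pose w n := iter n T (y n).
have wC n : (0 < n)%N -> C (w n) by move=> n0; apply: iter_C => //; exact: yC.
pose D n := `|x n - xs|.
have D_ge0 n : 0 <= D n by exact: normr_ge0.
pose c0 := `|S xs - xs|.
have c0_ge0 : 0 <= c0 by exact: normr_ge0.
pose e n := a n + beta n * c0.
have e0 n : (0 < n)%N -> 0 <= e n.
  move=> n0; rewrite addr_ge0 ?a_ge0// mulr_ge0//.
  by have /andP[] := beta_01 n n0.
have S_le (n : nat) : (0 < n)%N -> `|S (x n) - xs| <= D n + c0.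
  move=> n0; rewrite -[X in `|X|](subrKA (S xs)) (le_trans (ler_normD _ _))//.
  by rewrite lerD2r; apply: S_lip => //; exact: xC'.
have yD n : (0 < n)%N -> `|y n - xs| <= D n + beta n * c0.
  move=> n0; have /andP[b0 b1] := beta_01 n n0.
  have -> : y n - xs = beta n *: (S (x n) - xs) + (1 - beta n) *: (x n - xs).
    by rewrite yE//; apply: (ip_ext ip_norm) => r; rewrite !ip_lin; ring.
  rewrite (le_trans (ler_normD _ _))// !normrZ !ger0_norm ?subr_ge0// -/(D n).
  have : beta n * `|S (x n) - xs| <= beta n * (D n + c0).
    by rewrite ler_wpM2l// S_le.
  lra.
have wD n : (0 < n)%N -> `|w n - xs| <= D n + e n.
  move=> n0; have := T_near n _ _ (yC n n0) Cxs; rewrite (iter_fix Txs) a'E//.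
  by have := yD n n0; rewrite /e -/(w n); lra.
have ea : (fun n => e n / alpha n) @ \oo --> (0 : R).
  rewrite [X in X @ _](_ : _ = (fun n => a n / alpha n + beta n / alpha n * c0)).
    by apply: cvg0D => //; exact: cvg0Zr.
  by apply/funext => n; rewrite /e mulrDl mulrAC.
(* Half of the margin [k] absorbs the second order term of the gradient step,
   and the other half is the rate of contraction. *)
pose d := k / 2; pose kp := k / 2.
have kp0 : 0 < kp by rewrite divr_gt0.
have kpE : mu * eta - d - rho * gamma = kp by rewrite /d /kp /k; lra.
have dmu : d <= mu * eta by move: k0; rewrite /d /k; lra.
have small : \forall n \near \oo, [/\ (0 < n)%N,
    alpha n * (mu ^+ 2 * L ^+ 2) <= 2 * d, alpha n * (mu * eta - d) <= 1,
    alpha n * kp <= 1 & e n <= alpha n].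
  have near_small (c q : R) : 0 <= c -> 0 < q ->
      \forall n \near \oo, alpha n * c <= q.
    move=> c00 q0; have c1 : 0 < q / (c + 1) by rewrite divr_gt0// ltr_wpDl.
    apply: filterS (cvg0_near alpha_cvg0 c1) => n.
    move=> /(le_trans (ler_norm _)); rewrite ler_pdivlMr ?ltr_wpDl// => h.
    have [|an] := leP (alpha n) 0; last by lra.
    by move=> an; have : alpha n * c <= 0; [exact: mulr_le0_ge0|lra].
  have h1 : \forall n \near \oo, alpha n * (mu ^+ 2 * L ^+ 2) <= 2 * d.
    by apply: near_small; [rewrite mulr_ge0 ?sqr_ge0|rewrite mulr_gt0].
  have h2 : \forall n \near \oo, alpha n * (mu * eta - d) <= 1.
    by apply: near_small => //; lra.
  have h3 : \forall n \near \oo, alpha n * kp <= 1.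
    by apply: near_small => //; exact: ltW.
  have h4 : \forall n \near \oo, `|e n / alpha n| <= 1 by exact: cvg0_near.
  have h5 : \forall n \near \oo, (0 < n)%N by exists 1%N.
  near=> n; split; [by near: n|by near: n|by near: n|by near: n|].
  have n0 : (0 < n)%N by near: n.
  rewrite -[leRHS]mul1r -ler_pdivrMr ?al_pos//.
  by apply: (le_trans (ler_norm _)); near: n.
have step : \forall n \near \oo,
    D n.+1 ^+ 2 <= ((1 - alpha n * kp) * D n + e n) * D n.+1 +
                   alpha n * ip v (x n.+1 - xs).
  apply: filterS small => n [n0 s1 s2 _ _].
  have := projected_step ip_norm V_lip' F_lip' F_mono (ltW mu0) (ltW L_gt0) rho0
    C_closed C_convex (xC' _ n0) (wC _ n0) Cxs (ltW (al_pos _ n0))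
    s1 s2 (wD _ n0) (e0 _ n0) _.
  by rewrite kpE /= -xE//; apply.
have [B DB] : bounded_seq D.
  apply: (@quadratic_step_bounded _ alpha e D kp `|v|) => //.
  apply: filterS2 small step => n [n0 _ _ s3 s4] st.
  split=> //; first exact: al_pos n n0.
  by rewrite (le_trans st)// lerD2l ler_pM2l ?al_pos// ip_le.
have {}DB n : D n <= B by apply: le_trans (ler_norm _) (DB n).
have B0 : 0 <= B by exact: le_trans (normr_ge0 _) (DB 0%N).
have beta0 : beta @ \oo --> (0 : R).
  rewrite -(cvg_shiftS beta).
  rewrite [X in X @ _](_ : _ = (fun n => beta n.+1 / alpha n.+1 * alpha n.+1)).
    apply: cvg0M.
      by rewrite (cvg_shiftS (fun n => beta n / alpha n)).
    by rewrite (cvg_shiftS alpha).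
  by apply/funext => n; rewrite divfK// gt_eqF.
have [Ka aKa] := bounded_seq_cvg a_cvg0.
have eB n : (0 < n)%N -> e n <= Ka + c0.
  move=> n0; have /andP[_ b1] := beta_01 n n0.
  have h1 : beta n * c0 <= 1 * c0 by rewrite ler_wpM2r.
  have h2 := ler_norm (a n); have h3 := aKa n.
  by rewrite /e; lra.
(* A bound of [rho *: V (x n) - mu *: F (w n)]. *)
pose K2 := rho * (`|V xs| + gamma * B) + mu * (`|F xs| + L * (B + (Ka + c0))).
have orb : (fun n => `|x n.+1 - iter n T (x n)|) @ \oo --> (0 : R).
  pose r n := alpha n * K2 + beta n * (2 * B + c0) + a n.
  have r0 : r @ \oo --> (0 : R).
    by apply: cvg0D => //; apply: cvg0D; exact: cvg0Zr.
  apply: cvg0_le => f f0.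
  apply: filterS2 small (cvg0_near r0 f0) => n [n0 _ _ _ _].
  rewrite normr_id => /(le_trans (ler_norm _)); apply: le_trans.
  rewrite -[X in `|X|](subrKA (w n)) (le_trans (ler_normD _ _))// /r -addrA lerD//.
    rewrite xE//.
    apply: le_trans (metric_proj_le ip_norm _ C_closed C_neq0 C_convex (wC _ n0)) _.
    rewrite (_ : _ - w n = alpha n *: (rho *: V (x n) - mu *: F (w n))); last first.
      by apply: (ip_ext ip_norm) => q; rewrite !ip_lin; ring.
    rewrite normrZ ger0_norm ?(ltW (al_pos _ n0))// ler_pM2l ?al_pos//.
    rewrite (le_trans (ler_normB _ _))// !normrZ !ger0_norm ?(ltW mu0)//.
    rewrite lerD// ler_wpM2l ?(ltW mu0)//.
      rewrite -[X in `|X|](subrK (V xs)) addrC (le_trans (ler_normD _ _))// lerD2l.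
      rewrite (le_trans (V_lip' _ _ (xC' _ n0) Cxs))// ler_pM2l//; exact: DB.
    rewrite -[X in `|X|](subrK (F xs)) addrC (le_trans (ler_normD _ _))// lerD2l.
    rewrite (le_trans (F_lip' _ _ (wC _ n0) Cxs))// ler_pM2l//.
    by rewrite (le_trans (wD _ n0))// lerD// eB.
  rewrite (le_trans (T_near n _ _ (yC _ n0) (xC' _ n0)))// a'E// lerD2r.
  have /andP[b0 b1] := beta_01 n n0.
  rewrite (_ : y n - x n = beta n *: (S (x n) - x n)); last first.
    by rewrite yE//; apply: (ip_ext ip_norm) => q; rewrite !ip_lin; ring.
  rewrite normrZ ger0_norm// ler_wpM2l//.
  rewrite -[X in `|X|](subrKA xs) (le_trans (ler_normD _ _))// (distrC xs).
  by have := S_le n n0; have := DB n; rewrite -/(D n); lra.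
pose z n := x n.+1.
have bz : bounded_seq z.
  exists (B + `|xs|) => n; rewrite -[z n](subrK xs) (le_trans (ler_normD _ _))//.
  by rewrite lerD2r; exact: DB.
have orbz : asymp_orbit C T z.
  by split=> //; rewrite (cvg_shiftS (fun n => `|x n.+1 - iter n T (x n)|)).
rewrite -(cvg_shiftS x).
apply: (@viscosity_cvg _ _ _ _ _ _ (fun n => alpha n.+1) (fun n => e n.+1)
  _ _ _ _ ip_norm C_closed C_convex T_C T_demi erefl a'_cvg0 T_near
  T_asymp_reg (conj Cxs Txs) vi orbz kp0) => //.
- by move=> n; rewrite al0; have /andP[] := alpha_01 n.+1 isT.
- by rewrite (cvg_shiftS alpha).
- apply/cvgryPge => M; move/cvgryPge : alpha_sum => /(_ M).
  move=> [N _ NP]; exists N => // n /= Nn.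
  by have := NP n.+1 (leqW Nn); rewrite /= big_add1.
- apply: (@slow_variation _ (fun n => alpha n.+1)) => //.
  have := dalpha_alpha; rewrite -(cvg_shiftn 2); apply: cvg_trans.
  by apply: near_eq_cvg; apply: nearW => n /=; rewrite !addn2.
- by move=> n; exact: e0.
- by rewrite (cvg_shiftS (fun n => e n / alpha n)).
- have [N _ NP] := filterI small step; exists N => // n /= Nn.
  by have [[_ _ _ s3 _] st] := NP n.+1 (leqW Nn); split.
Unshelve. all: by end_near.
Qed.
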